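(* Let $w$ be an admissible sequence and $N\ge2$. (i) Suppose $d_*(w,1)$ is a complex Banach space and $W\neq\{0\}$ is a strictly convex complex Banach space. a) If $w\in\ell_N$, then the set $NA\mathcal{P}_k(d_*(w,1);W)$ is not dense in $\mathcal{P}_k(d_*(w,1);W)$ for any $k\ge N$. b) If $w\in\ell_r$ for some $1<r<\infty$, then the set $NA\mathcal{P}_k(d_*(w,1);\ell_r)$ is not dense in $\mathcal{P}_k(d_*(w,1);\ell_r)$ for any $k\ge1$. (ii) If $d_*(w,1)$ is a real Banach space and $w\in\ell_M\setminus\ell_{M-1}$ for some even $M$, then the set $NA\mathcal{P}_k(d_*(w,1);\ell_M)$ is not dense in $\mathcal{P}_k(d_*(w,1);\ell_M)$ for any $k\ge1$.
   Context: An admissible sequence is a decreasing (i.e. nonincreasing) sequence $w=(w_i)_{i\in\mathbb{N}}$ of nonnegative reals with $w_1=1$, $\lim_iw_i=0$, $\sum_iw_i=\infty$. Put $W(n)=\sum_{i=1}^nw_i$. $d_*(w,1)$ (the predual of the Lorentz sequence space $d(w,1)$) is the (real or complex) Banach space of all bounded scalar sequences $x=(x(i))_i$ with $\lim_{n\to\infty}\frac{\sum_{i=1}^nx^*(i)}{W(n)}=0$, where $x^*=(x^*(i))_i$ is the decreasing rearrangement of $(|x(i)|)_i$, with norm $\|x\|_W=\sup_n\frac{\sum_{i=1}^nx^*(i)}{W(n)}$. Target spaces ($W$, $\ell_r$, $\ell_M$) are over the same scalar field as $d_*(w,1)$; $M$ is a positive integer. For Banach spaces $X,Y$, $\mathcal{P}_k(X;Y)$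 is the Banach space of continuous polynomials of degree at most $k$ from $X$ to $Y$ (sums $\sum_{j=0}^kP_j$ of continuous $j$-homogeneous polynomials) with norm $\|P\|=\sup_{x\in B_X}\|P(x)\|$, $B_X$ the closed unit ball. $NA\mathcal{P}_k(X;Y)$ is the set of $P\in\mathcal{P}_k(X;Y)$ with $\|P(x_0)\|=\|P\|$ for some $x_0\in B_X$. *)

(* Defs.v *)
From HB Require Import structures.
From mathcomp Require Import all_boot all_order all_algebra finmap.
From mathcomp Require Import complex.
From mathcomp Require Import all_classical all_reals all_analysis.
From mathcomp Require Import ring.
Set Implicit Arguments.
Unset Strict Implicit.
Unset Printing Implicit Defensive.
Import Order.TTheory GRing.Theory Num.Theory numFieldNormedType.Exports.
Local Open Scope classical_set_scope.
Local Open Scope ring_scope.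
Local Open Scope card_scope.

(* The scalar field, real or complex.  Norms in MathComp-Analysis take values
   in the scalar field, so the norm of a space over R[i] lies in R[i];
   real_part turns such norms into elements of R, where suprema and powers
   with real exponents are available.  Only real_scalars and complex_scalars
   below are used. *)
Record scalars (R : realType) := Scalars {
  scalar_field :> numFieldType;
  of_real : {rmorphism R -> scalar_field};
  real_part : scalar_field -> R;
  of_realK : cancel of_real real_part;
  of_real_le : {mono of_real : x y / x <= y};
  real_partK : forall z, 0 <= z -> of_real (real_part z) = z }.

Lemma complex_scalar_subproof (R : realType) (z : R[i]) :
  0 <= z -> real_complex R (complex.Re z) = z.
Proof. by move=> z0; exact: RRe_real (ger0_real z0). Qed.

Definition real_scalars (R : realType) : scalars R :=
  @Scalars R R idfun idfun (fun=> erefl) (fun _ _ => erefl) (fun _ _ => erefl).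

Definition complex_scalars (R : realType) : scalars R :=
  @Scalars R R[i] (real_complex R) (@complex.Re R) (fun=> erefl) (@lecR R)
    (@complex_scalar_subproof R).

Section real_norm.
Context {R : realType} (S : scalars R).

Definition rnorm (V : normedZmodType S) (x : V) : R := real_part `|x|.

Lemma rnormK (V : normedZmodType S) (x : V) : of_real S (rnorm x) = `|x|.
Proof. exact: real_partK. Qed.

Lemma of_real_ge0 a : (0 <= of_real S a) = (0 <= a).
Proof. by rewrite -(rmorph0 (of_real S)) of_real_le. Qed.

Lemma of_real_inj : injective (of_real S).
Proof. exact: can_inj (@of_realK R S). Qed.

Variable V : normedZmodType S.
Implicit Types x y : V.

Lemma rnorm_ge0 x : 0 <= rnorm x.
Proof. by rewrite -of_real_ge0 rnormK. Qed.

Lemma rnorm_le x y : (rnorm x <= rnorm y) = (`|x| <= `|y|).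
Proof. by rewrite -(of_real_le S) !rnormK. Qed.

Lemma rnormD x y : rnorm (x + y) <= rnorm x + rnorm y.
Proof. by rewrite -(of_real_le S) rmorphD !rnormK ler_normD. Qed.

Lemma rnorm0 : rnorm (0 : V) = 0.
Proof. by apply: of_real_inj; rewrite rnormK normr0 rmorph0. Qed.

Lemma rnorm_eq0 x : rnorm x = 0 -> x = 0.
Proof.
by move=> x0; apply/eqP; rewrite -normr_eq0 -rnormK x0 rmorph0.
Qed.

End real_norm.

Section real_norm_module.
Context {R : realType} (S : scalars R).

Lemma rnormZ (V : normedModType S) (a : S) (x : V) :
  rnorm (a *: x) = rnorm (a : S^o) * rnorm x.
Proof. by apply: (@of_real_inj _ S); rewrite rmorphM !rnormK normrZ. Qed.

Lemma rnormM (a b : S) : rnorm (a * b : S^o) = rnorm (a : S^o) * rnorm (b : S^o).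
Proof. by apply: (@of_real_inj _ S); rewrite rmorphM !rnormK normrM. Qed.

End real_norm_module.

(* A function that is sublinear up to moduli of scalars is a seminorm. *)
Section norm_of_comb.
Context {R : realType} (S : scalars R) (V : lmodType S) (N : V -> R).
Hypotheses (N0 : N 0 = 0)
  (N_comb : forall (a : S) x y, N (a *: x + y) <= rnorm (a : S^o) * N x + N y).

Let rnorm1 : rnorm (1 : S^o) = 1.
Proof. by apply: (@of_real_inj _ S); rewrite rnormK normr1 rmorph1. Qed.

Lemma comb_normD x y : of_real S (N (x + y)) <= of_real S (N x) + of_real S (N y).
Proof.
rewrite -rmorphD of_real_le; have := N_comb 1 x y.
by rewrite scale1r rnorm1 mul1r.
Qed.

Lemma comb_norm_ge0 x : 0 <= N x.
Proof.
have := N_comb (-1) x x; rewrite scaleN1r addNr N0.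
have -> : rnorm (-1 : S^o) = 1.
  by apply: (@of_real_inj _ S); rewrite rnormK normrN1 rmorph1.
by rewrite mul1r -mulr2n pmulrn_lge0.
Qed.

Lemma comb_normZ (a : S) x : of_real S (N (a *: x)) = `|a| * of_real S (N x).
Proof.
have le b z : N (b *: z) <= rnorm (b : S^o) * N z.
  by have := N_comb b z 0; rewrite !addr0 N0 addr0.
apply/le_anti/andP; split.
  by rewrite -(rnormK (a : S^o)) -rmorphM of_real_le le.
have [->|a0] := eqVneq a 0.
  by rewrite normr0 mul0r scale0r of_real_ge0 comb_norm_ge0.
rewrite -ler_pdivlMl ?normr_gt0// -normfV -[in leLHS](scalerK a0 x).
by rewrite -(rnormK (a^-1 : S^o)) -rmorphM of_real_le le.
Qed.

End norm_of_comb.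

Section rearrangement.
Context {R : realType}.

(* Decreasing rearrangement of a bounded sequence of nonnegative reals,
   indexed from 0: the infimum of the levels exceeded by at most n terms of the
   sequence.  When a tends to 0 its successive values are the terms of a in
   nonincreasing order, with repetitions. *)
Definition rearr (a : nat -> R) (n : nat) : R :=
  inf [set t | 0 <= t /\ [set i | t < a i] #<= `I_n].

Implicit Types (a : nat -> R) (J : {fset nat}).

Local Notation lev a n := [set t | 0 <= t /\ [set i | t < a i] #<= `I_n].

Let lev_lb a n : has_lbound (lev a n).
Proof. by exists 0 => t []. Qed.

Let lev_neq0 a n : has_ubound (range a) -> lev a n !=set0.
Proof.
move=> [B aB]; exists (Num.max B 0); split; first by rewrite le_max lexx orbT.
rewrite (_ : [set i | _] = set0) ?card_le_emptyl//.
apply/seteqP; split => // i /=; apply/negP; rewrite -leNgt le_max.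
by rewrite aB//; exists i.
Qed.

Lemma rearr_ge0 a n : 0 <= rearr a n.
Proof.
rewrite /rearr; have [->|/set0P ne] := eqVneq (lev a n) set0.
  by rewrite inf0.
by apply: lb_le_inf => // t [].
Qed.

Lemma rearr_nonincreasing a n : (forall i, 0 <= a i) -> nonincreasing_seq a ->
  rearr a n = a n.
Proof.
move=> a0 ad; apply/le_anti/andP; split.
  apply: ge_inf => //; split=> //; apply: subset_card_le => i /= ai.
  by rewrite ltnNge; apply: contraTN ai => /ad; rewrite leNgt.
apply: lb_le_inf.
  by apply: lev_neq0; exists (a 0%N) => _ [i _ <-]; exact: ad.
move=> t [t0 tn]; rewrite leNgt; apply/negP => tan.
suff : `I_n.+1 #<= `I_n by rewrite card_le_II ltnn.
apply: card_le_trans tn; apply: subset_card_le => i /=.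
by rewrite ltnS => /ad; exact: lt_le_trans.
Qed.

Let fset_min a J : J != fset0 -> exists2 j, j \in J & forall i, i \in J -> a j <= a i.
Proof.
case/fset0Pn => j0 j0J.
pose f (i : J) := a (val i).
case: (@arg_minP _ _ _ [` j0J]%fset xpredT f isT) => i _ fi.
by exists (val i) => [|k kJ]; [exact: valP|exact: (fi [` kJ]%fset)].
Qed.

Lemma sum_le_rearr a J : has_ubound (range a) ->
  \sum_(i <- J) a i <= series (rearr a) #|` J|.
Proof.
move=> aB; move En : #|` J| => n; elim: n J En => [|n IH] J En.
  by move/eqP: En; rewrite cardfs_eq0 => /eqP ->; rewrite big_seq_fset0 /series /= big_geq.
have J0 : J != fset0 by rewrite -cardfs_eq0 En.
have [j jJ jmin] := fset_min a J0.
rewrite (big_fsetD1 j)//= seriesSr addrC lerD//.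
  apply: IH; have := cardfsD1 j J; rewrite jJ En => -[]//.
apply: lb_le_inf; first exact: lev_neq0.
move=> t [t0 tn]; rewrite leNgt; apply/negP => taj.
suff : `I_n.+1 #<= `I_n by rewrite card_le_II ltnn.
apply: card_le_trans tn.
have /card_eq_fsetP := En.
rewrite card_eq_le => /andP[_] /card_le_trans; apply.
by apply: subset_card_le => i /= iJ; rewrite (lt_le_trans taj)// jmin.
Qed.

Lemma rearr_le_sum a n e : has_ubound (range a) -> (forall i, 0 <= a i) -> 0 < e ->
  exists2 J, #|` J| = n & series (rearr a) n <= \sum_(i <- J) a i + e *+ n.
Proof.
move=> aB a0 e0; elim: n => [|n [J Jn JS]].
  by exists fset0; rewrite ?cardfs0// big_seq_fset0 /series /= big_geq// addr0.
suff [i iJ ai] : exists2 i, i \notin J & rearr a n - e <= a i.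
  exists (i |` J)%fset; first by rewrite cardfsU1 iJ Jn.
  rewrite seriesSr big_fsetU1//= mulrSr.
  rewrite [a i + _]addrC addrACA lerD// -lerBlDr//.
apply: contrapT => nex.
have H i : i \notin J -> a i < rearr a n - e.
  by move=> iJ; rewrite ltNge; apply/negP => ?; apply: nex; exists i.
have [i0 i0J] : exists i, i \notin J.
  apply: contrapT => /forallNP Hall.
  have : finite_set [set: nat].
    apply: (sub_finite_set _ (finite_fset J)) => i _ /=.
    by have /negP := Hall i; rewrite negbK.
  exact: infinite_nat.
have : rearr a n <= rearr a n - e.
  apply: ge_inf => //; split; first exact: le_trans (ltW (H _ i0J)).
  have /card_eq_fsetP := Jn.
  rewrite card_eq_le => /andP[+ _]; apply: card_le_trans.
  apply: subset_card_le => i /= ai; apply/negPn/negP => /H.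
  by rewrite ltNge (ltW ai).
by rewrite leNgt ltrBlDr ltrDl e0.
Qed.

Lemma series_rearr_comb a b c p q n :
  has_ubound (range a) -> has_ubound (range b) -> has_ubound (range c) ->
  (forall i, 0 <= c i) -> 0 <= p -> 0 <= q ->
  (forall i, c i <= p * a i + q * b i) ->
  series (rearr c) n <= p * series (rearr a) n + q * series (rearr b) n.
Proof.
move=> aB bB cB c0 p0 q0 cab; apply/ler_addgt0Pr => e e0.
have d0 : 0 < e / n.+1%:R by rewrite divr_gt0.
have [J Jn /le_trans] := rearr_le_sum n cB c0 d0; apply.
rewrite lerD//; last first.
  by rewrite -[leLHS]mulr_natr mulrAC ler_pdivrMr// ler_pM2l// ler_nat.
apply: (@le_trans _ _ (\sum_(i <- J) (p * a i + q * b i))).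
  by apply: ler_sum => i _.
by rewrite big_split/= -!mulr_sumr lerD// ler_wpM2l// -Jn sum_le_rearr.
Qed.

End rearrangement.

(* Sequences are indexed from 0: w i is the weight written $w_{i+1}$ when
   sequences start at 1, and series w n is then $W(n)$. *)
Definition admissible {R : realType} (w : nat -> R) : Prop :=
  [/\ w 0%N = 1, forall i, 0 <= w i, nonincreasing_seq w,
      w @ \oo --> 0 & series w @ \oo --> +oo].

Section lorentz_mean.
Context {R : realType} (S : scalars R) (w : nat -> R).

Definition moduli (x : nat -> S^o) (i : nat) : R := rnorm (x i).

(* n.+1 because the quotients range over n >= 1. *)
Definition lorentz_mean (x : nat -> S^o) (n : nat) : R :=
  series (rearr (moduli x)) n.+1 / series w n.+1.

Definition dstar_mem (x : nat -> S^o) : Prop :=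
  has_ubound (range (moduli x)) /\ lorentz_mean x @ \oo --> (0 : R).

Definition lorentz_norm (x : nat -> S^o) : R := sup (range (lorentz_mean x)).

Hypothesis adm : admissible w.
Implicit Types x y : nat -> S^o.

Lemma admissible_series_gt0 n : 0 < series w n.+1.
Proof.
have [w0 w_ge0 _ _ _] := adm.
rewrite /series /= big_nat_recl// w0 ltr_pwDl//.
exact: sumr_ge0.
Qed.

Lemma lorentz_mean_ge0 x n : 0 <= lorentz_mean x n.
Proof.
rewrite divr_ge0 ?(ltW (admissible_series_gt0 _))//.
by apply: sumr_ge0 => i _; exact: rearr_ge0.
Qed.

Lemma moduli_comb (a : S) x y i :
  moduli (a *: x + y) i <= rnorm (a : S^o) * moduli x i + 1 * moduli y i.
Proof.
by rewrite mul1r (le_trans (rnormD _ _))// lerD2r rnormZ.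
Qed.

Lemma ubound_moduli_comb (a : S) x y :
  has_ubound (range (moduli x)) -> has_ubound (range (moduli y)) ->
  has_ubound (range (moduli (a *: x + y))).
Proof.
move=> [B xB] [C yC]; exists (rnorm (a : S^o) * B + C) => _ [i _ <-].
rewrite (le_trans (moduli_comb _ _ _ _))// mul1r lerD//.
  by rewrite ler_wpM2l ?rnorm_ge0// xB//; exists i.
by apply: yC; exists i.
Qed.

Lemma lorentz_mean_comb (a : S) x y n :
  has_ubound (range (moduli x)) -> has_ubound (range (moduli y)) ->
  lorentz_mean (a *: x + y) n <= rnorm (a : S^o) * lorentz_mean x n + lorentz_mean y n.
Proof.
move=> bx by_; rewrite /lorentz_mean mulrA -mulrDl ler_wpM2r//.
  by rewrite invr_ge0 (ltW (admissible_series_gt0 _)).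
have := @series_rearr_comb R (moduli x) (moduli y) (moduli (a *: x + y))
  (rnorm (a : S^o)) 1 n.+1.
rewrite mul1r; apply=> //.
- exact: ubound_moduli_comb.
- by move=> i; exact: rnorm_ge0.
- exact: rnorm_ge0.
- exact: moduli_comb.
Qed.

Lemma dstar_mem_comb (a : S) x y :
  dstar_mem x -> dstar_mem y -> dstar_mem (a *: x + y).
Proof.
move=> [bx cx] [by_ cy]; split; first exact: ubound_moduli_comb.
apply: (@squeeze_cvgr _ _ _ _ (fun=> 0)
  (fun n => rnorm (a : S^o) * lorentz_mean x n + lorentz_mean y n)).
- by near=> n; rewrite lorentz_mean_ge0 lorentz_mean_comb.
- exact: cvg_cst.
- rewrite -[X in _ --> X](_ : rnorm (a : S^o) * 0 + 0 = 0); last by rewrite mulr0 addr0.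
  by apply: cvgD cy; apply: cvgMr.
Unshelve. all: by end_near. Qed.

Lemma moduli0 : moduli 0 = fun=> 0.
Proof. by apply/funext => i; rewrite /moduli rnorm0. Qed.

Lemma lorentz_mean0 : lorentz_mean 0 = fun=> 0.
Proof.
have r0 : rearr (moduli 0) = fun=> 0.
  apply/funext => n; apply/le_anti; rewrite rearr_ge0 andbT moduli0.
  apply: ge_inf; first by exists 0 => t [].
  split=> //; rewrite (_ : [set i | _] = set0) ?card_le_emptyl//.
  by apply/seteqP; split => // i /=; rewrite ltxx.
by apply/funext => n; rewrite /lorentz_mean r0 /series/= big1 ?mul0r.
Qed.

Lemma dstar_mem0 : dstar_mem 0.
Proof.
split; first by rewrite moduli0; exists 0 => _ [i _ <-].
by rewrite lorentz_mean0; exact: cvg_cst.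
Qed.

Lemma lorentz_norm0 : lorentz_norm 0 = 0.
Proof.
rewrite /lorentz_norm lorentz_mean0 (_ : range _ = [set 0]) ?sup1//.
by apply/seteqP; split => [_ [n _ <-]|_ ->] //; exists 0%N.
Qed.

Lemma ubound_lorentz_mean x : dstar_mem x -> has_ubound (range (lorentz_mean x)).
Proof.
move=> [_ cx]; have /cvg_seq_bounded : cvgn (lorentz_mean x) by apply/cvg_ex; exists 0.
move=> [M [_ MB]]; exists (M + 1) => _ [n _ <-].
by rewrite (le_trans (ler_norm _))//; apply: MB => //; rewrite ltrDl.
Qed.

Lemma lorentz_norm_comb (a : S) x y : dstar_mem x -> dstar_mem y ->
  lorentz_norm (a *: x + y) <= rnorm (a : S^o) * lorentz_norm x + lorentz_norm y.
Proof.
move=> dx dy; apply: ge_sup; first by exists (lorentz_mean (a *: x + y) 0%N); exists 0%N.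
move=> _ [n _ <-]; rewrite (le_trans (lorentz_mean_comb _ _ dx.1 dy.1))//.
rewrite lerD//; first rewrite ler_wpM2l ?rnorm_ge0//.
- by apply: ub_le_sup; [exact: ubound_lorentz_mean|exists n].
- by apply: ub_le_sup; [exact: ubound_lorentz_mean|exists n].
Qed.

Lemma moduli_le_norm x i : dstar_mem x -> moduli x i <= lorentz_norm x.
Proof.
move=> dx; apply: (@le_trans _ _ (lorentz_mean x 0%N)); last first.
  by apply: ub_le_sup; [exact: ubound_lorentz_mean|exists 0%N].
have [w0 _ _ _ _] := adm.
have := sum_le_rearr [fset i]%fset dx.1.
by rewrite big_seq_fset1 cardfs1 /lorentz_mean /series/= !big_nat1 w0 divr1.
Qed.

End lorentz_mean.

(* The predual d_*(w,1) of the Lorentz sequence space d(w,1). *)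
Definition dstar_pred {R : realType} (S : scalars R) (w : nat -> R)
  (adm : admissible w) : {pred nat -> S^o} := mem [set x | dstar_mem w x].
Arguments dstar_pred {R} S {w} adm.

Record dstar {R : realType} (S : scalars R) (w : nat -> R) (adm : admissible w) :=
  Dstar { dstar_val :> nat -> S^o; _ : dstar_val \in dstar_pred S adm }.
Arguments dstar {R} S {w} adm.

Section dstar_normed.
Context {R : realType} (S : scalars R) (w : nat -> R) (adm : admissible w).

HB.instance Definition _ := [isSub for @dstar_val R S w adm].
HB.instance Definition _ := [Choice of dstar S adm by <:].

Lemma dstar_submod_closed : submod_closed (dstar_pred S adm).
Proof.
split; first by rewrite inE; exact: dstar_mem0.
by move=> a x y; rewrite !inE => dx dy; exact: dstar_mem_comb.
Qed.

HB.instance Definition _ :=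
  GRing.isSubmodClosed.Build S (nat -> S^o) (dstar_pred S adm) dstar_submod_closed.
HB.instance Definition _ := [SubChoice_isSubLmodule of dstar S adm by <:].

Implicit Types x y : dstar S adm.

Lemma dstarP x : dstar_mem w x.
Proof. by case: x => x /=; rewrite inE. Qed.

Let N x : R := lorentz_norm w x.

Let N_comb (a : S) x y : N (a *: x + y) <= rnorm (a : S^o) * N x + N y.
Proof. by apply: lorentz_norm_comb => //; exact: dstarP. Qed.

Let N0 : N 0 = 0.
Proof. exact: lorentz_norm0. Qed.

Let N_eq0 x : of_real S (N x) = 0 -> x = 0.
Proof.
rewrite -(rmorph0 (of_real S)) => /of_real_inj x0.
apply/val_inj/funext => i /=; apply/(@rnorm_eq0 _ S)/le_anti.
by rewrite rnorm_ge0 andbT -x0; exact: (moduli_le_norm adm i (dstarP x)).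
Qed.

HB.instance Definition _ := @Lmodule_isNormed.Build S (dstar S adm)
  (of_real S \o N) (comb_normD N_comb) (comb_normZ N0 N_comb) N_eq0.

Lemma dstar_normE x : `|x| = of_real S (lorentz_norm w x).
Proof. by []. Qed.

End dstar_normed.

Section power_sums.
Context {R : realType} (r : R).
Hypothesis r1 : 1 <= r.
Implicit Types (a b c : nat -> R) (A B : R).

Let r0 : 0 < r. Proof. exact: lt_le_trans r1. Qed.

Let powRdiv x y : 0 <= x -> 0 < y -> (x / y) `^ r = x `^ r / y `^ r.
Proof.
move=> x0 y0; apply/(canRL (mulfK _)); first by rewrite gt_eqF ?powR_gt0.
by rewrite -powRM ?divr_ge0 ?(ltW y0)// divfK ?gt_eqF.
Qed.

Lemma power_sum_Minkowski a b c A B :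
  (forall i, 0 <= a i) -> (forall i, 0 <= b i) -> (forall i, 0 <= c i <= a i + b i) ->
  0 < A -> 0 < B ->
  (forall n, series (fun i => a i `^ r) n <= A `^ r) ->
  (forall n, series (fun i => b i `^ r) n <= B `^ r) ->
  forall n, series (fun i => c i `^ r) n <= (A + B) `^ r.
Proof.
move=> a0 b0 cab A0 B0 aA bB n.
have AB0 : 0 < A + B by rewrite addr_gt0.
pose t := A / (A + B).
have t0 : 0 <= t by rewrite divr_ge0 ?ltW.
have t1 : t <= 1 by rewrite ler_pdivrMr// mul1r lerDl ltW.
have tB : 1 - t = B / (A + B).
  by rewrite /t -{1}(divff (lt0r_neq0 AB0)) -mulrBl addrC addKr.
have key i : c i `^ r <=
    (A + B) `^ r * (t * (A `^ r)^-1 * a i `^ r + (1 - t) * (B `^ r)^-1 * b i `^ r).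
  have /andP[c0 ci] := cab i.
  apply: (@le_trans _ _ ((a i + b i) `^ r)).
    by apply: ge0_ler_powR; rewrite ?(ltW r0) ?nnegrE ?addr_ge0.
  have := convex_powR r1 (Itv01 t0 t1) (x := a i / A) (y := b i / B).
  rewrite !inE/= !in_itv/= !andbT !divr_ge0 ?(ltW A0) ?(ltW B0)// => /(_ isT isT).
  rewrite !convRE => cv.
  have {cv} : (t * (a i / A) + (1 - t) * (b i / B)) `^ r <=
    t * (a i / A) `^ r + (1 - t) * (b i / B) `^ r by exact: cv.
  have -> : t * (a i / A) + (1 - t) * (b i / B) = (a i + b i) / (A + B).
    by rewrite tB /t; field; rewrite !gt_eqF.
  rewrite !powRdiv ?addr_ge0// ler_pdivrMr ?powR_gt0// mulrC => /le_trans; apply.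
  by rewrite !mulrA [t * _ * _]mulrAC [(1 - t) * _ * _]mulrAC.
rewrite /series/=.
apply: (le_trans (ler_sum _ (fun i _ => key i))).
rewrite -mulr_sumr big_split/= -!mulr_sumr -[leRHS]mulr1 ler_wpM2l ?powR_ge0//.
rewrite -[leRHS](subrKC t) lerD//.
  rewrite -mulrA ger_pMr ?divr_gt0//.
  by rewrite mulrC ler_pdivrMr ?powR_gt0// mul1r aA.
rewrite -mulrA ger_pMr ?tB ?divr_gt0//.
by rewrite mulrC ler_pdivrMr ?powR_gt0// mul1r bB.
Qed.

End power_sums.

Section lr_space.
Context {R : realType} (S : scalars R) (r : R).

Definition lr_mem (x : nat -> S^o) : Prop := cvgn (series (fun i => moduli x i `^ r)).

Definition lr_norm (x : nat -> S^o) : R :=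
  limn (series (fun i => moduli x i `^ r)) `^ r^-1.

Hypothesis r1 : 1 <= r.
Implicit Types x y : nat -> S^o.

Let r0 : 0 < r. Proof. exact: lt_le_trans r1. Qed.

Let nd x : nondecreasing_seq (series (fun i => moduli x i `^ r)).
Proof. by apply: nondecreasing_series => i _ _; exact: powR_ge0. Qed.

Let lim_ge0 x : lr_mem x -> 0 <= limn (series (fun i => moduli x i `^ r)).
Proof.
move=> cx; apply: le_trans (nondecreasing_cvgn_le (@nd x) cx 0%N).
by rewrite /series/= big_geq.
Qed.

Lemma lr_bound x n : lr_mem x ->
  series (fun i => moduli x i `^ r) n <= lr_norm x `^ r.
Proof.
move=> cx; rewrite -powRrM mulVf ?gt_eqF// powRr1 ?lim_ge0//.
exact: nondecreasing_cvgn_le.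
Qed.

Lemma lr_boundP x A : 0 <= A ->
  (forall n, series (fun i => moduli x i `^ r) n <= A `^ r) ->
  lr_mem x /\ lr_norm x <= A.
Proof.
move=> A0 xA; have cx : lr_mem x.
  by apply: nondecreasing_is_cvgn => //; exists (A `^ r) => _ [n _ <-].
split=> //; rewrite -[leRHS](powRr1 A0) -(divff (lt0r_neq0 r0)) powRrM.
apply: ge0_ler_powR; rewrite ?nnegrE ?invr_ge0 ?powR_ge0 ?lim_ge0// ?(ltW r0)//.
by apply: limr_le => //; near=> n.
Unshelve. all: by end_near. Qed.

Let comb_eps (a : S) x y e : lr_mem x -> lr_mem y -> 0 < e ->
  lr_mem (a *: x + y) /\ lr_norm (a *: x + y) <=
  (rnorm (a : S^o) * lr_norm x + e) + (lr_norm y + e).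
Proof.
move=> lx ly e0.
have x0 : 0 <= rnorm (a : S^o) * lr_norm x by rewrite mulr_ge0 ?rnorm_ge0 ?powR_ge0.
have y0 : 0 <= lr_norm y by rewrite powR_ge0.
apply: lr_boundP; first by rewrite !addr_ge0// ltW.
apply: (@power_sum_Minkowski _ _ r1 (fun i => rnorm (a : S^o) * moduli x i) (moduli y)).
- by move=> i; rewrite mulr_ge0 ?rnorm_ge0.
- by move=> i; rewrite rnorm_ge0.
- by move=> i; rewrite rnorm_ge0/= (le_trans (moduli_comb _ _ _ _))// mul1r.
- by rewrite ltr_wpDl.
- by rewrite ltr_wpDl.
- move=> n; apply: (@le_trans _ _ ((rnorm (a : S^o) * lr_norm x) `^ r)).
    rewrite powRM ?rnorm_ge0 ?powR_ge0//.
    under eq_fun => i do rewrite powRM ?rnorm_ge0//.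
    by rewrite /series/= -mulr_sumr ler_wpM2l ?powR_ge0// lr_bound.
  by apply: ge0_ler_powR; rewrite ?nnegrE ?(ltW r0)// ?addr_ge0 ?(ltW e0)// lerDl ltW.
- move=> n; apply: (le_trans (lr_bound _ ly)).
  by apply: ge0_ler_powR; rewrite ?nnegrE ?(ltW r0)// ?addr_ge0 ?(ltW e0)// lerDl ltW.
Qed.

Lemma lr_mem_comb (a : S) x y : lr_mem x -> lr_mem y -> lr_mem (a *: x + y).
Proof. by move=> lx ly; exact: (comb_eps a lx ly ltr01).1. Qed.

Lemma lr_norm_comb (a : S) x y : lr_mem x -> lr_mem y ->
  lr_norm (a *: x + y) <= rnorm (a : S^o) * lr_norm x + lr_norm y.
Proof.
move=> lx ly; apply/ler_addgt0Pr => e e0.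
have e20 : 0 < e / 2 by rewrite divr_gt0.
apply: (le_trans (comb_eps a lx ly e20).2).
by rewrite addrACA -splitr.
Qed.

Let lr0 : lr_mem 0 /\ lr_norm 0 <= 0.
Proof.
apply: lr_boundP => // n; rewrite moduli0 /series/= big1 ?powR_ge0// => i _.
by rewrite powR0// gt_eqF.
Qed.

Lemma lr_mem0 : lr_mem 0. Proof. exact: lr0.1. Qed.

Lemma lr_norm0 : lr_norm 0 = 0.
Proof. by apply/le_anti; rewrite lr0.2 powR_ge0. Qed.

Lemma moduli_le_lr_norm x i : lr_mem x -> moduli x i <= lr_norm x.
Proof.
move=> lx; rewrite leNgt; apply/negP => xi.
have : moduli x i `^ r <= lr_norm x `^ r.
  apply: le_trans (lr_bound i.+1 lx).
  by rewrite /series/= big_nat_recr//= lerDr sumr_ge0// => j _; exact: powR_ge0.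
by rewrite leNgt gt0_ltr_powR// nnegrE ?powR_ge0 ?rnorm_ge0.
Qed.

End lr_space.

Definition lr_pred {R : realType} (S : scalars R) (r : R)
  (r1 : 1 <= r) : {pred nat -> S^o} := mem [set x | lr_mem r x].
Arguments lr_pred {R} S {r} r1.

Record lr {R : realType} (S : scalars R) (r : R) (r1 : 1 <= r) :=
  Lr { lr_val :> nat -> S^o; _ : lr_val \in lr_pred S r1 }.
Arguments lr {R} S {r} r1.

Section lr_normed.
Context {R : realType} (S : scalars R) (r : R) (r1 : 1 <= r).

HB.instance Definition _ := [isSub for @lr_val R S r r1].
HB.instance Definition _ := [Choice of lr S r1 by <:].

Lemma lr_submod_closed : submod_closed (lr_pred S r1).
Proof.
split; first by rewrite inE; exact: lr_mem0.
by move=> a x y; rewrite !inE => dx dy; exact: lr_mem_comb.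
Qed.

HB.instance Definition _ :=
  GRing.isSubmodClosed.Build S (nat -> S^o) (lr_pred S r1) lr_submod_closed.
HB.instance Definition _ := [SubChoice_isSubLmodule of lr S r1 by <:].

Implicit Types x y : lr S r1.

Lemma lrP x : lr_mem r x.
Proof. by case: x => x /=; rewrite inE. Qed.

Let N x : R := lr_norm r x.

Let N_comb (a : S) x y : N (a *: x + y) <= rnorm (a : S^o) * N x + N y.
Proof. by apply: lr_norm_comb => //; exact: (@lrP _). Qed.

Let N0 : N 0 = 0.
Proof. exact: lr_norm0. Qed.

Let N_eq0 x : of_real S (N x) = 0 -> x = 0.
Proof.
rewrite -(rmorph0 (of_real S)) => /of_real_inj x0.
apply/val_inj/funext => i /=; apply/(@rnorm_eq0 _ S)/le_anti.
by rewrite rnorm_ge0 andbT -x0; exact: (moduli_le_lr_norm r1 i (@lrP x)).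
Qed.

HB.instance Definition _ := @Lmodule_isNormed.Build S (lr S r1)
  (of_real S \o N) (comb_normD N_comb) (comb_normZ N0 N_comb) N_eq0.

Lemma lr_normE x : `|x| = of_real S (lr_norm r x).
Proof. by []. Qed.

End lr_normed.
Arguments lrP {R S r r1} x.

Lemma natr_ge1 (R : realType) (n : nat) : (0 < n)%N -> 1 <= n%:R :> R.
Proof. by rewrite ler1n. Qed.
Arguments natr_ge1 R {n}.

Section homogeneous_polynomials.
Context {K : numFieldType} (X Y : normedModType K).

Definition multilinear (j : nat) (A : ('I_j -> X) -> Y) : Prop :=
  forall (i : 'I_j) (u : 'I_j -> X), linear (fun x => A (dfwith u i x)).

(* P is the diagonal restriction of a j-linear map; no symmetry is required and
   continuity is imposed on P. *)
Definition cont_homog_poly (j : nat) (P : X -> Y) : Prop :=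
  (exists2 A : ('I_j -> X) -> Y, multilinear A & forall x, P x = A (fun=> x)) /\
  continuous P.

Definition poly_mem (k : nat) (P : X -> Y) : Prop :=
  exists2 Q : nat -> X -> Y, forall j, (j <= k)%N -> cont_homog_poly j (Q j) &
    forall x, P x = \sum_(j < k.+1) Q j x.

Lemma cont_homog_poly_comb j a P Q : cont_homog_poly j P -> cont_homog_poly j Q ->
  cont_homog_poly j (a *: P + Q).
Proof.
move=> [[A mA PA] cP] [[B mB QB] cQ]; split; last first.
  by move=> x; apply: cvgD (cQ x); apply: cvgZl_tmp; exact: cP.
exists (a *: A + B); last by move=> x; rewrite /= !fctE PA QB.
move=> i u b x y; rewrite !fctE mA mB !scalerDr !scalerA [a * b]mulrC.
by rewrite addrACA.
Qed.

Lemma cont_homog_poly0 j : cont_homog_poly j (0 : X -> Y).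
Proof.
split; last by move=> x; exact: cvg_cst.
by exists (fun=> 0) => // i u b x y; rewrite scaler0 addr0.
Qed.

Lemma cont_homog_polyZ j P (t : K) x : cont_homog_poly j P ->
  P (t *: x) = t ^+ j *: P x.
Proof.
move=> [[A mA PA] _]; rewrite !PA.
have AZ (i : 'I_j) (u : 'I_j -> X) (y : X) : A (dfwith u i (t *: y)) = t *: A (dfwith u i y).
  have A0 : A (dfwith u i 0) = 0.
    have /eqP := mA i u 1 0 0.
    by rewrite !scale1r addr0 -subr_eq subrr eq_sym => /eqP.
  by have := mA i u t y 0; rewrite addr0 A0 addr0.
pose v n (i : 'I_j) := if (i < n)%N then t *: x else x.
have H n : (n <= j)%N -> A (v n) = t ^+ n *: A (v 0%N).
  elim: n => [|n IH] nj; first by rewrite expr0 scale1r.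
  pose i := Ordinal nj.
  have vS y n' : n' = n \/ n' = n.+1 -> y = v n' i -> v n' = dfwith (v n) i y.
    move=> n'n yE; apply/funext => l; have [->|li] := eqVneq l i.
      by rewrite dfwithin.
    rewrite dfwithout 1?eq_sym// /v; have [->//|->] := n'n.
    by rewrite ltnS leq_eqVlt (_ : (l == n :> nat) = false)//; exact/negbTE.
  rewrite (vS (t *: x) n.+1); [|by right|by rewrite /v /= ltnSn].
  rewrite AZ -(vS x n); [|by left|by rewrite /v /= ltnn].
  by rewrite IH ?(ltnW nj)// scalerA exprS.
have := H j (leqnn j); rewrite /v /= => <-.
by congr A; apply/funext => i /=; rewrite ltn_ord.
Qed.

Lemma cont_homog_poly_bounded j P : cont_homog_poly j P ->
  exists2 M, 0 <= M & forall x, `|x| <= 1 -> `|P x| <= M.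
Proof.
move=> hP; have [_ cP] := hP.
have /cvgrPdist_le /(_ _ ltr01) := cP 0.
move=> /nbhs_ballP [d /= d0 dP].
have d20 : d / 2 != 0 by rewrite mulf_neq0 ?gt_eqF// invr_neq0.
exists (`|d / 2| ^- j * (1 + `|P 0|)).
  by rewrite mulr_ge0 ?addr_ge0// invr_ge0 exprn_ge0.
move=> x x1.
have : `|P (d / 2 *: x)| <= 1 + `|P 0|.
  rewrite -[in leLHS](subrK (P 0) (P _)) (le_trans (ler_normD _ _))// lerD2r distrC dP//.
  rewrite -ball_normE/= sub0r normrN normrZ gtr0_norm ?divr_gt0//.
  rewrite (@le_lt_trans _ _ (d / 2))//.
    by rewrite ger_pMr ?divr_gt0.
  by rewrite ltr_pdivrMr// mulr_natr mulr2n ltrDl.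
rewrite (cont_homog_polyZ _ _ hP) normrZ normrX.
by rewrite ler_pdivlMl// exprn_gt0// normr_gt0.
Qed.

Lemma poly_mem_comb k a P Q : poly_mem k P -> poly_mem k Q -> poly_mem k (a *: P + Q).
Proof.
move=> [P_ hP PE] [Q_ hQ QE]; exists (fun j => a *: P_ j + Q_ j).
  by move=> j jk; apply: cont_homog_poly_comb; [exact: hP|exact: hQ].
by move=> x; rewrite big_split/= !fctE PE QE scaler_sumr.
Qed.

Lemma poly_mem0 k : poly_mem k 0.
Proof.
exists (fun=> 0) => [j _|x]; first exact: cont_homog_poly0.
by rewrite big1.
Qed.

Lemma poly_mem_bounded k P : poly_mem k P ->
  exists2 M, 0 <= M & forall x, `|x| <= 1 -> `|P x| <= M.
Proof.
move=> [Q hQ PE].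
have /choice [M HM] (j : 'I_k.+1) :
    exists M, 0 <= M /\ forall x, `|x| <= 1 -> `|Q j x| <= M.
  by have [M ? ?] := cont_homog_poly_bounded (hQ j (leq_ord j)); exists M.
exists (\sum_(j < k.+1) M j); first by apply: sumr_ge0 => j _; exact: (HM j).1.
move=> x x1; rewrite PE (le_trans (ler_norm_sum _ _ _))//.
by apply: ler_sum => j _; exact: (HM j).2.
Qed.

Lemma poly_mem_eq0 k P : poly_mem k P -> (forall x, `|x| <= 1 -> P x = 0) -> P = 0.
Proof.
move=> [Q hQ PE] P0; apply/funext => x /=.
pose a : 'rV[K]_k.+1 := \row_i ((i.+1%:R * (1 + `|x|))^-1).
have x0 : 0 < 1 + `|x| by rewrite ltr_pwDl.
have a0 i : 0 < i.+1%:R * (1 + `|x|) by rewrite mulr_gt0.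
have Va : Vandermonde k.+1 a \in unitmx.
  rewrite unitmxE unitfE det_Vandermonde.
  apply/prodf_neq0 => i _; apply/prodf_neq0 => j ij.
  rewrite !mxE subr_eq0; apply/negP => /eqP/invr_inj/(mulIf (lt0r_neq0 x0))/eqP.
  by rewrite eqr_nat eqSS => /eqP ji; rewrite ji ltnn in ij.
pose c := invmx (Vandermonde k.+1 a) *m const_mx 1 : 'cV_k.+1.
have cE (j : 'I_k.+1) : \sum_(s < k.+1) a 0 s ^+ j * c s 0 = 1.
  have : (Vandermonde k.+1 a *m c) j 0 = 1 by rewrite /c mulKVmx// mxE.
  by rewrite mxE => <-; apply: eq_bigr => s _; rewrite [Vandermonde _ _ _ _]mxE.
have -> : P x = \sum_(s < k.+1) c s 0 *: P (a 0 s *: x).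
  under [RHS]eq_bigr => s _ do rewrite PE scaler_sumr.
  rewrite exchange_big PE/=; apply: eq_bigr => j _.
  under [RHS]eq_bigr => s _ do
    rewrite (cont_homog_polyZ _ _ (hQ j (leq_ord j))) scalerA mulrC.
  by rewrite -scaler_suml cE scale1r.
apply: big1 => s _; rewrite P0 ?scaler0// normrZ mxE gtr0_norm ?invr_gt0//.
rewrite ler_pdivrMl// mulr1 (@le_trans _ _ (1 + `|x|))//.
  by rewrite lerDr.
by rewrite ler_peMl ?ler1n ?(ltW x0).
Qed.

End homogeneous_polynomials.

(* $\mathcal{P}_k(X;Y)$ as a type, normed below by the supremum over the closed
   unit ball. *)
Definition npoly_pred {K : numFieldType} (k : nat) (X Y : normedModType K) :
  {pred X -> Y} := mem [set P | poly_mem k P].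
Arguments npoly_pred {K} k X Y.

Record npoly {K : numFieldType} (k : nat) (X Y : normedModType K) :=
  NPoly { npoly_val :> X -> Y; _ : npoly_val \in npoly_pred k X Y }.
Arguments npoly {K} k X Y.

Section npoly_lmodule.
Context {K : numFieldType} (k : nat) (X Y : normedModType K).

HB.instance Definition _ := [isSub for @npoly_val K k X Y].
HB.instance Definition _ := [Choice of npoly k X Y by <:].

Lemma npoly_submod_closed : submod_closed (npoly_pred k X Y).
Proof.
split; first by rewrite inE; exact: poly_mem0.
by move=> a x y; rewrite !inE => dx dy; exact: poly_mem_comb.
Qed.

HB.instance Definition _ :=
  GRing.isSubmodClosed.Build K (X -> Y) (npoly_pred k X Y) npoly_submod_closed.
HB.instance Definition _ := [SubChoice_isSubLmodule of npoly k X Y by <:].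

Lemma npolyP (P : npoly k X Y) : poly_mem k P.
Proof. by case: P => P /=; rewrite inE. Qed.

End npoly_lmodule.

Section npoly_normed.
Context {R : realType} (S : scalars R) (k : nat) (X Y : normedModType S).

Definition sup_norm (P : X -> Y) : R := sup [set rnorm (P x) | x in [set x | `|x| <= 1]].

Implicit Types P Q : npoly k X Y.

Let ball0 (P : X -> Y) : [set rnorm (P x) | x in [set x | `|x| <= 1]] !=set0.
Proof. by exists (rnorm (P 0)), 0 => //=; rewrite normr0. Qed.

Lemma ubound_npoly P : has_ubound [set rnorm (P x) | x in [set x | `|x| <= 1]].
Proof.
have [M M0 PM] := poly_mem_bounded (npolyP P).
exists (real_part M) => _ [x /= x1 <-].
by rewrite -(of_real_le S) rnormK real_partK// PM.
Qed.

Lemma npoly_le_norm P x : `|x| <= 1 -> rnorm (P x) <= sup_norm P.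
Proof. by move=> x1; apply: ub_le_sup; [exact: ubound_npoly|exists x]. Qed.

Let N P : R := sup_norm P.

Let N_comb (a : S) P Q : N (a *: P + Q) <= rnorm (a : S^o) * N P + N Q.
Proof.
apply: ge_sup => // _ [x /= x1 <-].
by rewrite (le_trans (rnormD _ _))// rnormZ lerD ?ler_wpM2l ?rnorm_ge0// npoly_le_norm.
Qed.

Let N0 : N 0 = 0.
Proof.
apply/le_anti/andP; split.
  by apply: ge_sup => // _ [x _ <-]; rewrite rnorm0.
apply: le_trans (rnorm_ge0 _) (npoly_le_norm (0 : npoly k X Y) (x := 0) _).
by rewrite normr0.
Qed.

Let N_eq0 P : of_real S (N P) = 0 -> P = 0.
Proof.
rewrite -(rmorph0 (of_real S)) => /of_real_inj P0; apply/val_inj.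
apply: (poly_mem_eq0 (npolyP P)) => x x1; apply/(@rnorm_eq0 _ S)/le_anti.
by rewrite rnorm_ge0 andbT -P0 npoly_le_norm.
Qed.

HB.instance Definition _ := @Lmodule_isNormed.Build S (npoly k X Y)
  (of_real S \o N) (comb_normD N_comb) (comb_normZ N0 N_comb) N_eq0.

Lemma npoly_normE P : `|P| = of_real S (sup_norm P).
Proof. by []. Qed.

End npoly_normed.

Definition norm_attaining {R : realType} (S : scalars R) (k : nat)
    (X Y : normedModType S) : set (npoly k X Y) :=
  [set P : npoly k X Y | exists2 x0, `|x0| <= 1 & `|P x0| = `|P| ].
Arguments norm_attaining {R} S k X Y.

Definition strictly_convex {K : numFieldType} (V : normedModType K) : Prop :=
  forall x y : V, `|x| = 1 -> `|y| = 1 -> x != y -> `|(2^-1 : K) *: (x + y)| < 1.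

(* Main.v *)
(* Let P attain its norm at x0.  The means of x0 tend to 0, so x0 + t e_j stays
   in the unit ball for all large j and all small t: t |-> |P (x0 + t e_j)| has a
   local maximum at 0.

   Complex case: by strict convexity of the target and the maximum modulus
   principle, P (x0 + t e_j) does not depend on t.  Take Q = (sum_i x_i ^ N) v
   with m = N for (i) a), or the inclusion of d_*(w,1) into l_r with m = 1 for
   (i) b); both are continuous by majorization of x by w.  The coefficient of
   t ^ m in Q (x0 + t e_j) does not tend to 0, and it is also that of
   (Q - P) (x0 + t e_j), hence at most a constant multiple of |Q - P|.

   Real case: F = |P| ^ M is a polynomial because M is even.  Its coefficients of
   t ^ i along e_j tend to 0 for 0 < i < M since w is not in l_(M-1), while for P
   close to the inclusion the coefficient of t ^ M is close to 1.  As j grows this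
   contradicts the local maximum at t = 0. *)
From mathcomp Require Import all_boot all_order all_algebra finmap.
From mathcomp Require Import complex.
From mathcomp Require Import all_classical all_reals all_analysis.
From mathcomp Require Import ring lra.
Set Implicit Arguments.
Unset Strict Implicit.
Unset Printing Implicit Defensive.
Require Import Defs.
Import Order.TTheory GRing.Theory Num.Theory numFieldNormedType.Exports.
Local Open Scope classical_set_scope.
Local Open Scope ring_scope.

(** * Polynomials along lines *)

(** No derivative is taken: a coefficient along a line is a fixed linear combination of values at
    the points [node s]. It is therefore linear in the function, bounded by finitely many values,
    and stable under pointwise limits. The nodes lie in (0, 1], so a point of the unit ball moved by
    [node s] along a unit vector stays in the ball of radius 2; this is the origin of
    [dilation_const k 2].

    The point where P attains its norm is known only after P is chosen, so the coefficient of the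
    target polynomial must be bounded below uniformly in the base point.

    Over the reals, a local maximum does not make a polynomial constant; it only forbids a positive
    increment. The terms of degree below M could compensate the positive term of degree M, so they
    must be made negligible, while those above M are merely bounded. Hence t is fixed small first,
    and only then is j taken large. A lower coefficient is homogeneous in the direction; if it did
    not vanish along the unit vectors, it would be unbounded on combinations of far unit vectors
    with weights w, all of which lie in the unit ball. *)

Section interpolation.
Context {K : numFieldType}.

Definition node (s : nat) : K := s.+1%:R^-1.

Lemma node_gt0 s : 0 < node s.
Proof. by rewrite invr_gt0. Qed.

Lemma norm_node_le1 s : `|node s| <= 1.
Proof. by rewrite gtr0_norm ?node_gt0// invf_le1// ler1n. Qed.

Definition interp k : 'M[K]_k.+1 := invmx (Vandermonde k.+1 (\row_s node s)).

Lemma mul_interp k : Vandermonde k.+1 (\row_s node s) *m interp k = 1%:M.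
Proof.
apply: mulmxV; rewrite unitmxE unitfE det_Vandermonde.
apply/prodf_neq0 => i _; apply/prodf_neq0 => j ij.
rewrite !mxE subr_eq0; apply/negP => /eqP/invr_inj/eqP.
by rewrite eqr_nat eqSS => /eqP ji; rewrite ji ltnn in ij.
Qed.

(** Column q of the inverse Vandermonde matrix is the functional reading the coefficient of t ^ q.
    The definition applies to any function. For q > k, [inord q] defaults to 0, so that norm bounds
    hold for every q. *)
Definition coef {Y : lmodType K} (k q : nat) (f : K -> Y) : Y :=
  \sum_(s < k.+1) interp k s (inord q) *: f (node s).

(** No node is 0, so the expansion may be given for nonzero t only; [homog_coef] obtains its
    expansion through the inverse of t. *)
Lemma coef_powers (Y : lmodType K) k q (f : K -> Y) (c : nat -> Y) : (q <= k)%N ->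
  (forall t, t != 0 -> f t = \sum_(i < k.+1) t ^+ i *: c i) -> coef k q f = c q.
Proof.
move=> qk fE; rewrite /coef.
under eq_bigr => s _ do rewrite (fE _ (lt0r_neq0 (node_gt0 _))) scaler_sumr.
rewrite exchange_big/=.
transitivity (\sum_(i < k.+1) (i == inord q)%:R *: c i).
  apply: eq_bigr => i _; under eq_bigr => s _ do rewrite scalerA.
  rewrite -scaler_suml; congr (_ *: _).
  have /matrixP /(_ i (inord q)) := mul_interp k; rewrite !mxE => <-.
  by apply: eq_bigr => s _; rewrite [Vandermonde _ _ _ _]mxE mxE mulrC.
rewrite (bigD1 (inord q : 'I_k.+1))//= eqxx scale1r inordK// big1 ?addr0//.
by move=> i /negPf ->; rewrite scale0r.
Qed.

Definition interp_norm k : K := \sum_(q < k.+1) \sum_(s < k.+1) `|interp k s q|.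

Lemma interp_norm_ge0 k : 0 <= interp_norm k.
Proof. by apply: sumr_ge0 => q _; exact: sumr_ge0. Qed.

Lemma norm_coef_le (Y : normedModType K) k q (f : K -> Y) B :
  0 <= B -> (forall s, `|f (node s)| <= B) -> `|coef k q f| <= interp_norm k * B.
Proof.
move=> B0 fB; rewrite (le_trans (ler_norm_sum _ _ _))//.
apply: (@le_trans _ _ ((\sum_(s < k.+1) `|interp k s (inord q)|) * B)).
  rewrite mulr_suml; apply: ler_sum => s _.
  by rewrite normrZ ler_wpM2l.
rewrite ler_wpM2r// [leRHS](bigD1 (inord q : 'I_k.+1))//= lerDl.
by apply: sumr_ge0 => i _; exact: sumr_ge0.
Qed.

Lemma coefB (Y : lmodType K) k q (f g : K -> Y) :
  coef k q (fun t => f t - g t) = coef k q f - coef k q g.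
Proof.
by rewrite /coef -sumrB; apply: eq_bigr => s _; rewrite scalerBr.
Qed.

End interpolation.

Lemma sum_powers_widen {K : nzRingType} (Y : lmodType K) j k (c : nat -> Y) (t : K) : (j <= k)%N ->
  \sum_(i < j.+1) t ^+ i *: c i =
  \sum_(i < k.+1) t ^+ i *: (if (i <= j)%N then c i else 0).
Proof.
move=> jk.
rewrite (big_ord_widen_cond k.+1 xpredT (fun i => t ^+ i *: c i))// big_mkcond/=.
by apply: eq_bigr => i _; rewrite ltnS; case: ifP => // _; rewrite scaler0.
Qed.

Section polynomials_along_lines.
Context {K : numFieldType}.

Definition polyfun {Y : lmodType K} k (f : K -> Y) :=
  exists c : nat -> Y, forall t, f t = \sum_(i < k.+1) t ^+ i *: c i.

(** Replaces [poly_mem] wherever no multilinear form is at hand, as for powers of norms or for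
    [homog_part]. *)
Definition polyline {X Y : lmodType K} k (F : X -> Y) :=
  forall x y, polyfun k (fun t => F (x + t *: y)).

Lemma polyfun_coef (Y : lmodType K) k (f : K -> Y) : polyfun k f ->
  forall t, f t = \sum_(i < k.+1) t ^+ i *: coef k i f.
Proof.
move=> [c fc] t; rewrite fc; apply: eq_bigr => i _.
by rewrite (coef_powers (c := c))// -ltnS.
Qed.

Lemma polyfun_widen (Y : lmodType K) j k (f : K -> Y) :
  (j <= k)%N -> polyfun j f -> polyfun k f.
Proof.
move=> jk [c fc]; exists (fun i => if (i <= j)%N then c i else 0) => t.
by rewrite fc (sum_powers_widen _ _ jk).
Qed.

Lemma polyfun_sum (Y : lmodType K) (I : Type) (s : seq I) k (f : I -> K -> Y) :
  (forall i, polyfun k (f i)) -> polyfun k (fun t => \sum_(i <- s) f i t).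
Proof.
move=> pf; exists (fun j => \sum_(i <- s) coef k j (f i)) => t.
under eq_bigr => i _ do rewrite (polyfun_coef (pf i)).
by rewrite exchange_big/=; apply: eq_bigr => j _; rewrite scaler_sumr.
Qed.

Lemma polyfunZ (Y : lmodType K) k a (f : K -> Y) :
  polyfun k f -> polyfun k (fun t => a *: f t).
Proof.
move=> [c fc]; exists (fun j => a *: c j) => t; rewrite fc scaler_sumr.
by apply: eq_bigr => i _; rewrite !scalerA mulrC.
Qed.

Lemma polyfun_dilate (Y : lmodType K) k a (f : K -> Y) :
  polyfun k f -> polyfun k (fun t => f (t * a)).
Proof.
move=> [c fc]; exists (fun j => a ^+ j *: c j) => t; rewrite fc.
by apply: eq_bigr => i _; rewrite !scalerA exprMn.
Qed.

(** Induction on the number of slots that contain t: linearity in the next slot gives t times a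
    polynomial plus another one, both of the previous degree. *)
Lemma multilinear_polyfun (X Y : normedModType K) j (A : ('I_j -> X) -> Y) x y :
  multilinear A -> polyfun j (fun t => A (fun=> x + t *: y)).
Proof.
move=> mA.
suff H n : (n <= j)%N -> forall u : 'I_j -> X,
    polyfun n (fun t => A (fun i : 'I_j => if (i < n)%N then x + t *: y else u i)).
  have [c Hc] := H j (leqnn j) (fun=> 0); exists c => t; rewrite -Hc.
  by congr A; apply/funext => i; rewrite ltn_ord.
elim: n => [|n IH] nj u.
  by exists (fun=> A u) => t; rewrite big_ord_recl big_ord0 addr0 expr0 scale1r.
pose i0 := Ordinal nj.
have [c Hc] := IH (ltnW nj) (dfwith u i0 x).
have [d Hd] := IH (ltnW nj) (dfwith u i0 y).
exists (fun q => (if q is q'.+1 then d q' else 0) + (if (q <= n)%N then c q else 0)) => t.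
pose v := fun i : 'I_j => if (i < n)%N then x + t *: y else u i.
have vE z : dfwith v i0 z = (fun i : 'I_j => if (i < n)%N then x + t *: y else dfwith u i0 z i).
  apply/funext => i; have [->|ii0] := eqVneq i i0.
    by rewrite !dfwithin /= ltnn.
  by rewrite !dfwithout 1?eq_sym.
have -> : (fun i : 'I_j => if (i < n.+1)%N then x + t *: y else u i) =
    dfwith v i0 (t *: y + x).
  apply/funext => i; have [->|ii0] := eqVneq i i0.
    by rewrite dfwithin /= ltnSn addrC.
  rewrite dfwithout 1?eq_sym// /v ltnS leq_eqVlt (_ : (i == n :> nat) = false)//.
  exact/negbTE.
rewrite mA !vE Hc Hd.
under [in RHS]eq_bigr => q _ do rewrite scalerDr.
rewrite big_split/=; congr (_ + _).
  rewrite [RHS]big_ord_recl /= scaler0 add0r scaler_sumr.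
  by apply: eq_bigr => q _; rewrite scalerA -exprS.
rewrite [RHS]big_ord_recr/= ltnn scaler0 addr0; apply: eq_bigr => q _.
by rewrite -ltnS ltn_ord.
Qed.

Lemma poly_mem_polyline (X Y : normedModType K) k (P : X -> Y) :
  poly_mem k P -> polyline k P.
Proof.
move=> [Q hQ PE] x y.
suff /polyfun_sum -/(_ (index_enum 'I_k.+1)) [c Hc] (j : 'I_k.+1) :
    polyfun k (fun t => Q j (x + t *: y)).
  by exists c => t; rewrite PE -Hc.
have [[A mA QA] _] := hQ j (leq_ord j).
have [c Hc] := polyfun_widen (leq_ord j) (multilinear_polyfun x y mA).
by exists c => t; rewrite QA Hc.
Qed.

Definition dilation_const k (t : K) : K := \sum_(i < k.+1) t ^+ i * interp_norm k.

Lemma dilation_const_ge0 k t : 0 <= t -> 0 <= dilation_const k t.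
Proof.
by move=> t0; apply: sumr_ge0 => i _; rewrite mulr_ge0 ?exprn_ge0 ?interp_norm_ge0.
Qed.

(** Along the ray from 0 through x, interpolation inside the unit ball bounds each coefficient by
    [interp_norm k * B]; evaluation at t multiplies the i-th one by t ^ i. *)
Lemma polyline_dilate (X Y : normedModType K) k (P : X -> Y) B t x :
  polyline k P -> (forall y, `|y| <= 1 -> `|P y| <= B) ->
  0 < t -> `|x| <= t -> `|P x| <= dilation_const k t * B.
Proof.
move=> pP PB t0 xt.
have B0 : 0 <= B by apply: le_trans (PB 0 _); rewrite ?normr0.
pose y := t^-1 *: x.
have y1 : `|y| <= 1.
  by rewrite normrZ gtr0_norm ?invr_gt0// ler_pdivrMl// mulr1.
have -> : x = 0 + t *: y by rewrite add0r scalerA divff ?gt_eqF// scale1r.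
rewrite (polyfun_coef (pP 0 y)) (le_trans (ler_norm_sum _ _ _))// mulr_suml.
apply: ler_sum => i _; rewrite normrZ normrX gtr0_norm// -mulrA.
rewrite ler_wpM2l ?exprn_ge0 ?(ltW t0)// norm_coef_le// => s.
rewrite PB// add0r normrZ (le_trans _ y1)// ler_piMl//.
exact: norm_node_le1.
Qed.

(** Along the unit direction from x to z the constant terms cancel, and each of the k remaining
    terms has a factor at most |z - x| once |z - x| <= 1. Their coefficients are bounded
    independently of the direction, by the values on the ball of radius |x| + 1. *)
Lemma polyline_continuous (X Y : normedModType K) k (P : X -> Y) B :
  polyline k P -> (forall y, `|y| <= 1 -> `|P y| <= B) -> continuous P.
Proof.
move=> pP PB x.
have B0 : 0 <= B by apply: le_trans (PB 0 _); rewrite ?normr0.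
pose t := `|x| + 1.
have t0 : 0 < t by rewrite ltr_wpDl.
pose C := (interp_norm k * (dilation_const k t * B)) *+ k.
have C0 : 0 <= C.
  by rewrite mulrn_wge0// !mulr_ge0 ?interp_norm_ge0 ?dilation_const_ge0// ltW.
apply/cvgrPdist_le => /= e e0.
have d0 : 0 < e / (C + 1) by rewrite divr_gt0// ltr_wpDl.
near=> z.
have zx : `|z - x| <= 1 by rewrite distrC; near: z; exact: cvgr_dist_le.
have [->|zNx] := eqVneq z x; first by rewrite subrr normr0 ltW.
have zx0 : 0 < `|z - x| by rewrite normr_gt0 subr_eq0.
pose y := `|z - x|^-1 *: (z - x).
have y1 : `|y| = 1 by rewrite normrZ normfV normr_id mulVf ?gt_eqF.
have zE : z = x + `|z - x| *: y.
  by rewrite scalerA divff ?gt_eqF// scale1r addrC subrK.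
have Px : P x = P (x + 0 *: y) by rewrite scale0r addr0.
rewrite distrC Px [in P z]zE !(polyfun_coef (pP x y)) -sumrB big_ord_recl/= !expr0 subrr add0r.
apply: (@le_trans _ _ (\sum_(i < k) `|z - x| * (interp_norm k * (dilation_const k t * B)))).
  rewrite (le_trans (ler_norm_sum _ _ _))//; apply: ler_sum => i _.
  rewrite expr0n /= scale0r subr0 normrZ normrX normr_id ler_pM ?exprn_ge0//.
    by rewrite exprS ger_pMr// exprn_ile1.
  apply: norm_coef_le => [|s]; first by rewrite mulr_ge0 ?dilation_const_ge0// ltW.
  apply: polyline_dilate => //; rewrite (le_trans (ler_normD _ _))// lerD2l.
  by rewrite normrZ y1 mulr1 norm_node_le1.
rewrite sumr_const card_ord -mulrnAr -/C.
apply: (@le_trans _ _ (e / (C + 1) * (C + 1))).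
  apply: ler_pM => //; last by rewrite lerDl.
by rewrite divfK// gt_eqF// ltr_wpDl.
Unshelve. all: by end_near. Qed.

Lemma multilinear_cont_homog_poly (X Y : normedModType K) j (A : ('I_j -> X) -> Y) B :
  multilinear A -> (forall x, `|x| <= 1 -> `|A (fun=> x)| <= B) ->
  cont_homog_poly j (fun x => A (fun=> x)).
Proof.
move=> mA AB; split; first by exists A.
by apply: (@polyline_continuous _ _ j _ B) => // x y; exact: multilinear_polyfun.
Qed.

Lemma cont_homog_poly_mem (X Y : normedModType K) j k (P : X -> Y) :
  (j <= k)%N -> cont_homog_poly j P -> poly_mem k P.
Proof.
move=> jk hP; exists (fun i => if i == j then P else 0).
  by move=> i _; case: eqP => [->//|_]; exact: cont_homog_poly0.
move=> x; rewrite (bigD1 (Ordinal (jk : (j < k.+1)%N)))//= eqxx big1 ?addr0//.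
by move=> i; rewrite -val_eqE/= => /negPf ->.
Qed.

End polynomials_along_lines.

(** * The unit ball of d_*(w,1) *)

Section admissible_weights.
Context {R : realType} (w : nat -> R).
Hypothesis adm : admissible w.

Lemma admissible_ge0 i : 0 <= w i. Proof. by case: adm. Qed.

Lemma admissible_le i j : (i <= j)%N -> w j <= w i.
Proof. by case: adm => _ _ nw _ _; exact: nw. Qed.

Lemma admissible_le1 i : w i <= 1.
Proof. by have [<- _ _ _ _] := adm; exact: admissible_le. Qed.

(** A zero weight would make all later weights vanish and the partial sums of w bounded. *)
Lemma admissible_gt0 i : 0 < w i.
Proof.
rewrite lt_neqAle admissible_ge0 andbT eq_sym; apply/eqP => wi.
have [_ _ _ _ /cvgryPge /(_ (series w i + 1)) [n _ nW]] := adm.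
have := nW (n + i)%N (leq_addr _ _).
rewrite leNgt => /negP; apply.
rewrite /series/= (big_cat_nat (leq0n i) (leq_addl n i))/=.
rewrite (_ : \sum_(i <= j < n + i) w j = 0) ?addr0 ?ltrDl//.
rewrite big_nat big1// => j /andP[ij _].
by apply/le_anti; rewrite admissible_ge0 andbT -wi admissible_le.
Qed.

Lemma admissible_series_ge1 n : 1 <= series w n.+1.
Proof.
have [w0 _ _ _ _] := adm.
rewrite /series/= big_nat_recl// w0 lerDl; apply: sumr_ge0 => i _.
exact: admissible_ge0.
Qed.

Lemma admissible_series_le n : series w n <= n%:R.
Proof.
rewrite /series/= -[leRHS]mulr1 mulr_natl -[n in leRHS]subn0 -sumr_const_nat.
by apply: ler_sum => i _; exact: admissible_le1.
Qed.

Lemma admissible_series_homo m n : (m <= n)%N -> series w m <= series w n.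
Proof. by apply: nondecreasing_series => i _ _; exact: admissible_ge0. Qed.

End admissible_weights.

Lemma series_rearr_le {R : realType} (a : nat -> R) n B :
  has_ubound (range a) -> (forall i, 0 <= a i) ->
  (forall J : {fset nat}, #|` J| = n -> \sum_(i <- J) a i <= B) ->
  series (rearr a) n <= B.
Proof.
move=> aB a0 JB; apply/ler_addgt0Pr => e e0.
have d0 : 0 < e / n.+1%:R by rewrite divr_gt0.
have [J Jn /le_trans] := rearr_le_sum n aB a0 d0; apply.
rewrite lerD ?JB// -[leLHS]mulr_natr mulrAC ler_pdivrMr// ler_pM2l//.
by rewrite ler_nat.
Qed.

Section dstar_geometry.
Context {R : realType} {S : scalars R} {w : nat -> R} (adm : admissible w).
Implicit Types x y : dstar S adm.

Lemma of_real_le1 (a : R) : (of_real S a <= 1) = (a <= 1).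
Proof. by rewrite -(rmorph1 (of_real S)) of_real_le. Qed.

Lemma rnorm1 : rnorm (1 : S^o) = 1.
Proof. by apply: (@of_real_inj _ S); rewrite rnormK normr1 rmorph1. Qed.

Lemma moduli_ge0 (x : nat -> S^o) i : 0 <= moduli x i.
Proof. exact: rnorm_ge0. Qed.

Lemma fset_sum_le_norm (x : nat -> S^o) (J : {fset nat}) : dstar_mem w x ->
  \sum_(i <- J) moduli x i <= lorentz_norm w x * series w #|` J|.
Proof.
move=> dx; have [J0|] := posnP #|` J|.
  by rewrite J0 /series/= big_geq// mulr0; move/eqP: J0;
    rewrite cardfs_eq0 => /eqP ->; rewrite big_seq_fset0.
case En : #|` J| => [//|n] _; apply: (le_trans (sum_le_rearr J dx.1)).
rewrite En -ler_pdivrMr ?admissible_series_gt0//.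
by apply: ub_le_sup; [exact: ubound_lorentz_mean|exists n].
Qed.

(** Rids later arguments of the rearrangement: when one coordinate changes, each of these
    constraints changes by at most one term. *)
Lemma dstar_ballP x : `|x| <= 1 <->
  forall J : {fset nat}, \sum_(i <- J) moduli x i <= series w #|` J|.
Proof.
rewrite dstar_normE of_real_le1; split=> [x1 J|xJ].
  apply: le_trans (fset_sum_le_norm J (dstarP x)) _.
  rewrite ler_piMl//; apply: sumr_ge0 => i _; exact: admissible_ge0.
apply: ge_sup; first by exists (lorentz_mean w x 0%N); exists 0%N.
move=> _ [n _ <-]; rewrite /lorentz_mean ler_pdivrMr ?admissible_series_gt0// mul1r.
apply: series_rearr_le => [|i|J <-]; [exact: (dstarP x).1|exact: moduli_ge0|exact: xJ].
Qed.

(** For a summable sequence the means are at most B / W(n), and W tends to infinity. *)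
Lemma dstar_memI (x : nat -> S^o) B : has_ubound (range (moduli x)) ->
  (forall J : {fset nat}, \sum_(i <- J) moduli x i <= B) -> dstar_mem w x.
Proof.
move=> bx xB; split=> //.
have cW : (fun n => B / series w n.+1) @ \oo --> (0 : R).
  rewrite -[X in _ --> X](mulr0 B); apply: cvgMr.
  apply/gtr0_cvgV0; first by near=> n; exact: admissible_series_gt0.
  by rewrite (cvg_shiftS (series w)); case: adm.
apply: (squeeze_cvgr _ (cvg_cst _) cW).
near=> n; rewrite lorentz_mean_ge0//= ler_wpM2r//.
  by rewrite invr_ge0 (ltW (admissible_series_gt0 _ _)).
by apply: series_rearr_le => // i; exact: moduli_ge0.
Unshelve. all: by end_near. Qed.

Definition unit_seq (j : nat) : nat -> S^o := fun i => (i == j)%:R.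

Lemma moduli_unit_seq j i : moduli (unit_seq j) i = (i == j)%:R.
Proof.
by rewrite /moduli /unit_seq; case: eqP => _; rewrite ?rnorm1 ?rnorm0.
Qed.

Lemma fset_sum_unit_seq j (J : {fset nat}) :
  \sum_(i <- J) moduli (unit_seq j) i <= 1.
Proof.
under eq_bigr do rewrite moduli_unit_seq.
have [jJ|jJ] := boolP (j \in J).
  rewrite (big_fsetD1 j)//= eqxx big_seq big1 ?addr0// => i.
  by rewrite !inE => /andP[/negPf ->].
by rewrite big_seq big1// => i iJ; case: eqP => // ij; rewrite -ij iJ in jJ.
Qed.

Lemma dstar_mem_unit j : dstar_mem w (unit_seq j).
Proof.
apply: (@dstar_memI _ 1); last exact: fset_sum_unit_seq.
by exists 1 => _ [i _ <-]; rewrite moduli_unit_seq lern1 leq_b1.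
Qed.

Definition unitv j : dstar S adm := Dstar (mem_set (dstar_mem_unit j)).

Lemma norm_unitv_le1 j : `|unitv j| <= 1.
Proof.
apply/dstar_ballP => J; have [J0|] := posnP #|` J|.
  by rewrite J0 /series/= big_geq//; move/eqP: J0;
    rewrite cardfs_eq0 => /eqP ->; rewrite big_seq_fset0.
case: #|` J| => // n _; apply: le_trans (admissible_series_ge1 adm n).
exact: fset_sum_unit_seq.
Qed.

Lemma dstarE_lin x (t : S) j i : (x + t *: unitv j) i = x i + t * (i == j)%:R.
Proof. by []. Qed.

Lemma moduli_neq x (t : S) j i : i != j -> moduli (x + t *: unitv j) i = moduli x i.
Proof. by move=> /negPf ij; rewrite /moduli dstarE_lin ij mulr0 addr0. Qed.

Lemma moduli_eq_le x (t : S) j :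
  moduli (x + t *: unitv j) j <= moduli x j + rnorm (t : S^o).
Proof. by rewrite /moduli dstarE_lin eqxx mulr1 rnormD. Qed.

Lemma fset_sum_update x (t : S) j (J : {fset nat}) : j \in J ->
  \sum_(i <- J) moduli (x + t *: unitv j) i =
  moduli (x + t *: unitv j) j + \sum_(i <- (J `\ j)%fset) moduli x i.
Proof.
move=> jJ; rewrite (big_fsetD1 j)//=; congr (_ + _).
rewrite big_seq [RHS]big_seq; apply: eq_bigr => i; rewrite !inE => /andP[ij _].
exact: moduli_neq.
Qed.

Lemma fset_sum_update_notin x (t : S) j (J : {fset nat}) : j \notin J ->
  \sum_(i <- J) moduli (x + t *: unitv j) i = \sum_(i <- J) moduli x i.
Proof.
move=> jJ; rewrite big_seq [RHS]big_seq; apply: eq_bigr => i iJ.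
by apply: moduli_neq; apply: contraNneq jJ => <-.
Qed.

(** If moduli above d occurred arbitrarily far, n of them would sum to at least d n >= d W(n), and
    no mean could fall below d. *)
Lemma dstar_small_coords x d : 0 < d ->
  exists n0, forall i, (n0 <= i)%N -> moduli x i <= d.
Proof.
move=> d0; apply: contrapT => /forallNP nex.
have ex n : exists2 i, (n <= i)%N & d < moduli x i.
  have /existsNP [i /not_implyP[ni /negP]] := nex n.
  by rewrite -ltNge; exists i.
(* The bound b on the indices of J guarantees that the next index is new. *)
have exJ n : exists2 J : {fset nat}, #|` J| = n &
    (exists b, forall i, i \in J -> (i < b)%N) /\ forall i, i \in J -> d < moduli x i.
  elim: n => [|n [J Jn [[b Jb] Jd]]].
    by exists fset0; rewrite ?cardfs0//; split=> //; exists 0%N.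
  have [i bi di] := ex b; exists (i |` J)%fset.
    rewrite cardfsU1 Jn (_ : i \notin J)//.
    by apply/negP => /Jb; rewrite ltnNge bi.
  split=> [|k]; last by rewrite !inE => /orP[/eqP ->//|]; exact: Jd.
  exists i.+1 => k; rewrite !inE ltnS => /orP[/eqP ->//|/Jb kb].
  exact: leq_trans (ltnW kb) bi.
have [bx /cvgrPdist_lt/(_ _ d0) [n _ /(_ n (leqnn n))]] := dstarP x.
rewrite /= sub0r normrN ger0_norm ?lorentz_mean_ge0// ltNge => /negP; apply.
have [J Jn [_ Jd]] := exJ n.+1.
rewrite /lorentz_mean ler_pdivlMr ?admissible_series_gt0//.
apply: (@le_trans _ _ (\sum_(i <- J) moduli x i)); last by rewrite -Jn sum_le_rearr.
apply: (@le_trans _ _ (d * n.+1%:R)).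
  by rewrite ler_pM2l// admissible_series_le.
rewrite -Jn cardfE -sum1_card natr_sum mulr_sumr big_seq_fsetE/=.
by apply: ler_sum => i _; rewrite mulr1 ltW// Jd// fsvalP.
Qed.

(* A vector of the unit ball can be perturbed along all far coordinates: since
   the means tend to 0, only finitely many of the constraints
   [\sum_(i <- J) moduli x i <= W(#J)] are within 1/2 of being tight, and for
   those the slack [w n] is available. *)
Lemma dstar_flat x : `|x| <= 1 -> exists n0, exists2 d : R, 0 < d &
  forall j (t : S), (n0 <= j)%N -> rnorm (t : S^o) <= d -> `|x + t *: unitv j| <= 1.
Proof.
move=> /dstar_ballP x1.
have [bx /cvgrPdist_le] := dstarP x.
have h0 : 0 < 2^-1 :> R by rewrite invr_gt0.
move=> /(_ _ h0) [n1 _ n1x].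
have wn := admissible_gt0 adm n1.
have w4 : 0 < w n1 / 4 by rewrite divr_gt0.
have [n0 n0x] := dstar_small_coords x w4.
exists n0, (w n1 / 4) => // j t jn td; apply/dstar_ballP => J.
have [jJ|/fset_sum_update_notin ->//] := boolP (j \in J).
have xj : moduli (x + t *: unitv j) j <= w n1 / 2.
  apply: le_trans (moduli_eq_le _ _ _) _; have := n0x j jn; lra.
rewrite fset_sum_update//; have := cardfsD1 j J; rewrite jJ add1n => Jm.
(* With fewer than n1 other indices, the new entry is paid by the next weight, at least w n1.
   Otherwise the sum of x over J uses at most half of W, and w n1 / 2 <= 1 / 2 fits into the other
   half. *)
have [mn1|n1m] := ltnP #|` (J `\ j)%fset| n1.
  rewrite Jm seriesSr addrC; apply: lerD; first exact: x1.
  have := admissible_le adm (ltnW mn1); lra.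
set m := #|` (J `\ j)%fset| in Jm n1m.
have := n1x m n1m; rewrite /= sub0r normrN ger0_norm ?lorentz_mean_ge0//.
rewrite /lorentz_mean ler_pdivrMr ?admissible_series_gt0// => xm.
have := sum_le_rearr J bx; rewrite (big_fsetD1 j)//= Jm => xJ.
have := admissible_series_ge1 adm m; have := admissible_le1 adm n1.
have := moduli_ge0 x j; lra.
Qed.

End dstar_geometry.

(** * The complex maximum modulus principle *)

Lemma npoly_norm_le {R : realType} (S : scalars R) k (X Y : normedModType S)
  (P : npoly k X Y) x : `|x| <= 1 -> `|P x| <= `|P|.
Proof.
by move=> x1; rewrite npoly_normE -rnormK of_real_le; exact: npoly_le_norm.
Qed.

(** The triangle inequality forces both norms to equal t; strict convexity then applies after
    division by t. *)
Lemma strictly_convex_midpoint {K : numFieldType} (Y : normedModType K) (x y : Y) t :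
  strictly_convex Y -> `|x| <= t -> `|y| <= t -> `|(2^-1 : K) *: (x + y)| = t -> x = y.
Proof.
move=> sc xt yt xyt.
have t0 : 0 <= t by rewrite -xyt.
have [t00|tN0] := eqVneq t 0.
  by move: xt yt; rewrite t00 !normr_le0 => /eqP -> /eqP ->.
have {t0}t0 : 0 < t by rewrite lt_def tN0.
have sum2 : t + t <= `|x| + `|y|.
  have -> : t + t = `|x + y|.
    rewrite -[x + y]scale1r -(@divff _ (2 : K)) ?pnatr_eq0// -scalerA normrZ xyt.
    by rewrite gtr0_norm// mulr_natl mulr2n.
  exact: ler_normD.
have xE : `|x| = t.
  apply/le_anti; rewrite xt/= -(lerD2r t); apply: le_trans sum2 _.
  by rewrite lerD2l.
have yE : `|y| = t.
  by apply/le_anti; rewrite yt/= -(lerD2l t) (le_trans sum2)// lerD2r.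
apply/eqP; apply: contraT => xy.
have nt (z : Y) : `|z| = t -> `|t^-1 *: z| = 1.
  by move=> zt; rewrite normrZ normfV gtr0_norm// zt mulVf.
have := sc (t^-1 *: x) (t^-1 *: y) (nt _ xE) (nt _ yE).
rewrite -scalerDr scalerA mulrC -scalerA nt ?ltxx//; apply.
by apply: contra_neq xy => /(scalerI (invr_neq0 tN0)).
Qed.

Lemma sum_double {V : nmodType} (f : nat -> V) n :
  \sum_(i < n.*2) f i = \sum_(i < n) (f i.*2 + f i.*2.+1).
Proof.
elim: n => [|n IH]; first by rewrite !big_ord0.
by rewrite doubleS !big_ord_recr/= IH addrA.
Qed.

Section maximum_modulus.
Context {R : realType} (Y : normedModType R[i]).
Hypothesis sc : strictly_convex Y.

(* The even part of a polynomial is a polynomial of half the degree in t ^ 2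
   obeying the same bound, hence constant by induction; strict convexity then
   identifies the two values whose midpoint it is. *)
Lemma pow2_maximum_modulus m (c : nat -> Y) (d : R[i]) : 0 < d ->
  (forall t, `|t| <= d -> `|\sum_(i < 2 ^ m) t ^+ i *: c i| <= `|c 0%N|) ->
  forall t, `|t| <= d -> \sum_(i < 2 ^ m) t ^+ i *: c i = c 0%N.
Proof.
elim: m c d => [|m IH] c d d0 cd t td.
  by rewrite expn0 big_ord_recl big_ord0 addr0 expr0 scale1r.
pose p (t : R[i]) := \sum_(i < 2 ^ m.+1) t ^+ i *: c i.
have evenE s : (2^-1 : R[i]) *: (p s + p (- s)) =
    \sum_(i < 2 ^ m) (s ^+ 2) ^+ i *: c i.*2.
  rewrite /p expnS mul2n (sum_double (fun i => s ^+ i *: c i)).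
  rewrite (sum_double (fun i => (- s) ^+ i *: c i)) -big_split/= scaler_sumr.
  apply: eq_bigr => i _; rewrite [s ^+ i.*2.+1]exprS [(- s) ^+ i.*2.+1]exprS.
  rewrite -!mul2n !exprM sqrrN mulNr scaleNr addrACA subrr addr0 -mulr2n.
  by rewrite scalerMnl scalerA -[_ ^+ i *+ 2]mulr_natl mulKf ?pnatr_eq0.
have N2 : `|2^-1 : R[i]| = 2^-1 by rewrite gtr0_norm// invr_gt0.
have even_const s : `|s| <= d -> (2^-1 : R[i]) *: (p s + p (- s)) = c 0%N.
  move=> sd; rewrite evenE; apply: (IH (fun i => c i.*2) (d ^+ 2)).
  - exact: exprn_gt0.
  (* Complex scalars enter here: every u in the disc of radius d ^ 2 is a square of some v in the
     disc of radius d, so the even part is controlled on the whole disc. *)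
  - move=> u ud; pose v := sqrtC u.
    have vd : `|v| <= d.
      by rewrite -(@ler_pXn2r _ 2)// ?nnegrE ?(ltW d0)// -normrX sqrtCK.
    rewrite -[u]sqrtCK -evenE normrZ N2 ler_pdivrMl// mulr_natl mulr2n double0.
    by rewrite (le_trans (ler_normD _ _))// lerD// cd ?normrN.
  - by rewrite normrX lerXn2r ?nnegrE ?(ltW d0).
rewrite -/(p t) -(even_const t td).
have -> : p t = p (- t).
  apply: (strictly_convex_midpoint sc (t := `|c 0%N|)); rewrite ?cd ?normrN//.
  by rewrite even_const.
by rewrite -mulr2n -[X in _ *: X]scaler_nat scalerA mulVf ?pnatr_eq0// scale1r.
Qed.

(** Since k < 2 ^ k, padding with zero coefficients gives a number of terms that can be halved
    repeatedly. *)
Lemma polyfun_maximum_modulus k (f : R[i] -> Y) (d : R[i]) : polyfun k f -> 0 < d ->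
  (forall t, `|t| <= d -> `|f t| <= `|f 0|) -> forall t, `|t| <= d -> f t = f 0.
Proof.
move=> pf d0 fd t td.
have kk : (k <= (2 ^ k).-1)%N by rewrite -ltnS prednK ?expn_gt0// ltn_expl.
have [c] := polyfun_widen kk pf; rewrite prednK ?expn_gt0// => fc.
have f0 : f 0 = c 0%N.
  rewrite fc; have -> : (2 ^ k = (2 ^ k).-1.+1)%N by rewrite prednK ?expn_gt0.
  rewrite big_ord_recl expr0 scale1r big1 ?addr0// => i _.
  by rewrite expr0n scale0r.
rewrite f0 fc; apply: (pow2_maximum_modulus d0) => // s sd.
by rewrite -fc -f0 fd.
Qed.

(** The nodes may lie outside the disc of radius d. The dilated function t |-> f (t d) is constant
    at all of them, and its coefficient of order q is d ^ q times that of f. *)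
Lemma polyfun_flat_coef0 k (f : R[i] -> Y) (d : R[i]) q : polyfun k f -> 0 < d ->
  (forall t, `|t| <= d -> `|f t| <= `|f 0|) -> (0 < q <= k)%N -> coef k q f = 0.
Proof.
move=> pf d0 fd /andP[q0 qk].
have fcst := polyfun_maximum_modulus pf d0 fd.
have h1 : coef k q (fun t => f (t * d)) = d ^+ q *: coef k q f.
  apply: (coef_powers (c := fun i => d ^+ i *: coef k i f)) => // t _.
  by rewrite (polyfun_coef pf); apply: eq_bigr => i _; rewrite scalerA exprMn.
have h2 : coef k q (fun t => f (t * d)) = coef k q (fun=> f 0).
  apply: eq_bigr => s _; rewrite fcst// normrM gtr0_norm ?node_gt0//.
  by rewrite gtr0_norm// ger_pMl// -[leLHS]gtr0_norm ?node_gt0// norm_node_le1.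
have h3 : coef k q (fun=> f 0) = 0.
  rewrite (coef_powers (c := fun i => if i == 0%N then f 0 else 0))//.
    by rewrite gtn_eqF.
  move=> t _; rewrite big_ord_recl/= expr0 scale1r big1 ?addr0// => i _.
  by rewrite scaler0.
apply: (scalerI (lt0r_neq0 (exprn_gt0 q d0))).
by rewrite scaler0 -h1 h2 h3.
Qed.

End maximum_modulus.

(** * Perturbations along unit vectors *)

Section perturbation.
Context {R : realType} {S : scalars R} {w : nat -> R} (adm : admissible w).
Local Notation X := (dstar S adm).

Lemma norm_add_unitv_le2 (x : X) (t : S) j : `|x| <= 1 -> `|t| <= 1 ->
  `|x + t *: unitv adm j| <= 2.
Proof.
move=> x1 t1; rewrite (le_trans (ler_normD _ _))// -[leRHS]/(1 + 1) lerD//.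
by rewrite normrZ mulr_ile1// norm_unitv_le1.
Qed.

Lemma npoly_ball2 k (Y : normedModType S) (P : npoly k X Y) x :
  `|x| <= 2 -> `|P x| <= dilation_const k 2 * `|P|.
Proof.
apply: polyline_dilate => //; first exact: poly_mem_polyline (npolyP P).
by move=> y; exact: npoly_norm_le.
Qed.

Lemma norm_coef_npoly_le k (Y : normedModType S) (P : npoly k X Y) x j q : `|x| <= 1 ->
  `|coef k q (fun t => P (x + t *: unitv adm j))|
    <= interp_norm k * (dilation_const k 2 * `|P|).
Proof.
move=> x1; apply: norm_coef_le => [|s]; first by rewrite mulr_ge0// dilation_const_ge0.
by apply/npoly_ball2/norm_add_unitv_le2; rewrite ?norm_node_le1.
Qed.

End perturbation.

(** * Criterion for non-density over the complex scalars *)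

Section complex_case.
Context {R : realType} {w : nat -> R} (adm : admissible w).
Local Notation X := (dstar (complex_scalars R) adm).

(** Common core of both complex statements. The radius e / (C + 1) is chosen so that C e / (C + 1) <
    e, where C bounds the passage from the norm of a polynomial to its coefficients. *)
Lemma not_dense_of_coef (Y : normedModType R[i]) k m (Q : npoly k X Y) (e : R[i]) :
  strictly_convex Y -> (0 < m <= k)%N -> 0 < e ->
  (forall x j, e <= `|coef k m (fun t => Q (x + t *: unitv adm j))|) ->
  ~ dense (norm_attaining (complex_scalars R) k X Y).
Proof.
move=> sc mk e0 Qe dn.
pose C : R[i] := interp_norm k * dilation_const k 2.
have C0 : 0 <= C by rewrite mulr_ge0 ?interp_norm_ge0 ?dilation_const_ge0.
have C1 : 0 < C + 1 by rewrite ltr_wpDl.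
have d0 : 0 < e / (C + 1) by rewrite divr_gt0.
have [|P [QP [x x1 Px]]] := dn (ball Q (e / (C + 1))) _ (ball_open _ _).
  by exists Q; exact: ballxx.
have [n0 [d d_gt0 flat]] := dstar_flat x1.
pose f t := P (x + t *: unitv adm n0).
have f0 : f 0 = P x by rewrite /f scale0r addr0.
have P0 : coef k m f = 0.
  apply: (polyfun_flat_coef0 sc (d := real_complex R d)) => //.
  - exact: poly_mem_polyline (npolyP P) _ _.
  - by rewrite ltcR.
  - move=> t td; rewrite f0 Px; apply: (npoly_norm_le (S := complex_scalars R)); apply: flat => //.
    by rewrite -(of_real_le (complex_scalars R)) rnormK.
have := Qe x n0.
have -> : coef k m (fun t => Q (x + t *: unitv adm n0)) =
    coef k m (fun t => (Q - P) (x + t *: unitv adm n0)).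
  by rewrite -[LHS]subr0 -P0 -coefB.
apply/negP; rewrite -real_ltNge ?normr_real ?gtr0_real//.
have h := norm_coef_npoly_le (Q - P : npoly k X Y) n0 m x1.
apply: le_lt_trans h _; rewrite mulrA -/C.
move: QP; rewrite -ball_normE /= => QP.
apply: (@le_lt_trans _ _ (C * (e / (C + 1)))); first by rewrite ler_wpM2l// ltW.
by rewrite mulrCA gtr_pMr// ltr_pdivrMr// mul1r ltrDl.
Qed.

End complex_case.

(** * The inclusion of d_*(w,1) into l_r *)

Section majorization.
Context {R : realType}.
Implicit Types a b c g : nat -> R.

(** Summation by parts. The term with factor [g m] in the induction claim is the boundary term,
    which is nonnegative at the end. *)
Lemma abel_le b c g n : (forall i, 0 <= g i) -> nonincreasing_seq g ->
  (forall m, (m <= n)%N -> series b m <= series c m) ->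
  \sum_(0 <= i < n) b i * g i <= \sum_(0 <= i < n) c i * g i.
Proof.
move=> g0 gd bc.
suff H m : (m <= n)%N -> (series c m - series b m) * g m <=
    \sum_(0 <= i < m) c i * g i - \sum_(0 <= i < m) b i * g i.
  by rewrite -subr_ge0 (le_trans _ (H n (leqnn n)))// mulr_ge0// subr_ge0 bc.
elim: m => [|m IH] mn; first by rewrite /series/= !big_geq// subrr mul0r.
have gm : g m.+1 <= g m by apply: gd.
rewrite !big_nat_recr//=.
apply: (@le_trans _ _ ((series c m.+1 - series b m.+1) * g m)).
  by rewrite ler_wpM2l// subr_ge0 bc.
rewrite !seriesSr; have := IH (ltnW mn); lra.
Qed.

(** Sorting only the first n terms preserves their power sums exactly, while each initial sum is
    still a sum of a over a finite set, to which a majorization hypothesis applies. *)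
Lemma decreasing_arrangement a n : (forall i, 0 <= a i) ->
  exists b, [/\ forall i, 0 <= b i, nonincreasing_seq b,
    forall m, (m <= n)%N -> exists2 J : {fset nat}, #|` J| = m &
      series b m = \sum_(i <- J) a i &
    forall f : R -> R, \sum_(0 <= i < n) f (b i) = \sum_(0 <= i < n) f (a i)].
Proof.
move=> a0; pose leT := [rel i j | a j <= a i].
have leT_total : total leT by move=> i j; exact: le_total.
pose s := sort leT (iota 0 n).
have ss : size s = n by rewrite size_sort size_iota.
have us : uniq s by rewrite sort_uniq iota_uniq.
have so : sorted leT s by exact: sort_sorted.
pose b i := if (i < n)%N then a (nth 0%N s i) else 0.
have bE m (f : R -> R) : (m <= n)%N ->
    \sum_(0 <= i < m) f (b i) = \sum_(i <- take m s) f (a i).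
  move=> mn; rewrite [RHS](big_nth 0%N) size_take_min ss (minn_idPl mn).
  rewrite [LHS]big_nat [RHS]big_nat.
  apply: eq_bigr => i /= im.
  by rewrite nth_take// /b (leq_trans im mn).
exists b; split=> [i|i j ij|m mn|f].
- by rewrite /b; case: ifP.
- rewrite /b; case: (ltnP j n) => jn; last by case: ifP.
  rewrite (leq_ltn_trans ij jn).
  apply: (@sorted_leq_nth _ leT _ _ 0%N s so) => //.
  + by move=> y x z /= xy yz; exact: le_trans yz xy.
  + by move=> x /=.
  + by rewrite inE ss (leq_ltn_trans ij jn).
  + by rewrite inE ss.
- have ut : uniq (take m s) by exact: take_uniq.
  exists [fset i in take m s]%fset.
    by rewrite card_fseq undup_id// size_take_min ss (minn_idPl mn).
  rewrite /series/= (bE m id)//; apply: perm_big.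
  by apply: uniq_perm; rewrite ?fset_uniq// => i; rewrite inE.
- rewrite bE// take_oversize ?ss//; apply: perm_big.
  by rewrite /index_iota subn0 perm_sort.
Qed.

(** With b the sorted terms, the sum of b ^ r = b b ^ (r - 1) is at most that of c b ^ (r - 1) by
    Abel summation. Young's inequality bounds the latter by C / r + (1 - 1 / r) B, and the multiple
    of B is absorbed on the left. *)
Lemma powR_sum_majorization r a c n : 1 < r ->
  (forall i, 0 <= a i) -> (forall i, 0 <= c i) ->
  (forall J : {fset nat}, \sum_(i <- J) a i <= series c #|` J|) ->
  series (fun i => a i `^ r) n <= series (fun i => c i `^ r) n.
Proof.
move=> r1 a0 c0 ac.
have r0 : 0 < r by exact: lt_trans r1.
have [b [b0 bd bJ bE]] := decreasing_arrangement n a0.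
rewrite /series/= -(bE (fun x => x `^ r)).
set B := \sum_(0 <= i < n) b i `^ r; set C := \sum_(0 <= i < n) c i `^ r.
have rB0 : 0 <= r - 1 by rewrite subr_ge0 ltW.
have H : B <= \sum_(0 <= i < n) c i * b i `^ (r - 1).
  have -> : B = \sum_(0 <= i < n) b i * b i `^ (r - 1).
    by apply: eq_bigr => i _; rewrite mulr_powRB1.
  apply: (@abel_le b c (fun i => b i `^ (r - 1))) => [i|i j ij|m mn].
  - exact: powR_ge0.
  - by apply: ge0_ler_powR; rewrite ?nnegrE//; exact: bd.
  - by have [J Jm ->] := bJ m mn; rewrite -Jm.
have Y : \sum_(0 <= i < n) c i * b i `^ (r - 1) <= C / r + (1 - r^-1) * B.
  rewrite mulrC !mulr_sumr -big_split/=; apply: ler_sum => i _.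
  have q0 : 0 < r / (r - 1) by rewrite divr_gt0// subr_gt0.
  apply: le_trans (conjugate_powR (c0 i) (powR_ge0 (b i) (r - 1)) r0 q0 _) _.
    rewrite invf_div mulrBl mul1r divff ?gt_eqF//.
    by rewrite addrC subrK.
  rewrite -powRrM mulrC lerD2l mulrC invf_div mulrBl mul1r divff ?gt_eqF//.
  by rewrite mulrCA divff ?mulr1// gt_eqF// subr_gt0.
have := le_trans H Y; rewrite mulrBl mul1r addrCA -subr_ge0 addrAC subrr add0r.
by rewrite [C / r]mulrC -mulrBr pmulr_rge0 ?invr_gt0// subr_ge0.
Qed.

End majorization.

Section inclusion.
Context {R : realType} {S : scalars R} {w : nat -> R} (adm : admissible w).
Context {r : R} (r1 : 1 < r) (wr : lr_mem (S := real_scalars R) r w).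
Local Notation X := (dstar S adm).

Lemma moduli_weights : moduli (S := real_scalars R) w = w.
Proof.
by apply/funext => i; rewrite /moduli /rnorm/= ger0_norm// admissible_ge0.
Qed.

Lemma dstar_lr (x : X) : lr_mem r x /\
  lr_norm r x <= lorentz_norm w x * lr_norm (S := real_scalars R) r w.
Proof.
have L0 : 0 <= lorentz_norm w x by rewrite -(of_real_ge0 S) -dstar_normE.
apply: (lr_boundP (ltW r1)) => [|n]; first by rewrite mulr_ge0// powR_ge0.
have cw i : 0 <= lorentz_norm w x * w i by rewrite mulr_ge0// admissible_ge0.
apply: (@le_trans _ _ (series (fun i => (lorentz_norm w x * w i) `^ r) n)).
  apply: powR_sum_majorization => // [i|J]; first exact: moduli_ge0.
  by rewrite /series/= -mulr_sumr; exact: fset_sum_le_norm (dstarP x).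
rewrite powRM ?powR_ge0//.
under eq_fun => i do rewrite powRM ?admissible_ge0//.
rewrite /series/= -mulr_sumr ler_wpM2l ?powR_ge0//.
by have := lr_bound (ltW r1) n wr; rewrite moduli_weights.
Qed.

(** The proof [r1'] is a parameter because the uses carry different ones: [ltW] of a strict
    inequality, or [natr_ge1]. *)
Definition incl (r1' : 1 <= r) (x : X) : lr S r1' := Lr (mem_set (dstar_lr x).1).

Lemma norm_incl_le (r1' : 1 <= r) x : `|x| <= 1 ->
  `|incl r1' x| <= of_real S (lr_norm (S := real_scalars R) r w).
Proof.
rewrite lr_normE of_real_le dstar_normE of_real_le1 => x1.
by apply: le_trans (dstar_lr x).2 _; rewrite ler_piMl// powR_ge0.
Qed.

Lemma norm_incl_unitv_ge1 (r1' : 1 <= r) j : 1 <= `|incl r1' (unitv adm j)|.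
Proof.
rewrite lr_normE -(rmorph1 (of_real S)) of_real_le.
have := moduli_le_lr_norm r1' j (dstar_lr (unitv adm j)).1.
by rewrite moduli_unit_seq eqxx.
Qed.

Lemma incl_linear (r1' : 1 <= r) (t : S) x y :
  incl r1' (t *: x + y) = t *: incl r1' x + incl r1' y.
Proof. exact/val_inj. Qed.

Lemma incl_poly_mem (r1' : 1 <= r) k : (1 <= k)%N -> poly_mem k (incl r1').
Proof.
move=> k1; apply: (cont_homog_poly_mem k1).
apply: (multilinear_cont_homog_poly (A := fun u : 'I_1 -> X => incl r1' (u ord0))).
  by move=> i u t x y; rewrite (ord1 i) !dfwithin incl_linear.
by move=> x; exact: norm_incl_le.
Qed.

Definition incl_poly (r1' : 1 <= r) k (k1 : (1 <= k)%N) : npoly k X (lr S r1') :=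
  NPoly (mem_set (incl_poly_mem r1' k1)).

Lemma coef_incl_poly (r1' : 1 <= r) k (k1 : (1 <= k)%N) x j :
  coef k 1 (fun t => incl_poly r1' k1 (x + t *: unitv adm j)) = incl r1' (unitv adm j).
Proof.
rewrite (coef_powers (c := fun i => if i is i'.+1 then
  (if i' is 0%N then incl r1' (unitv adm j) else 0) else incl r1' x))//.
move=> t _; case: k k1 => // k k1; rewrite /= addrC incl_linear.
rewrite !big_ord_recl/= big1; last by move=> i _; rewrite scaler0.
by rewrite expr0 expr1 scale1r addr0 addrC.
Qed.

End inclusion.

(** * Strict convexity of complex l_r for r > 1 *)

Section lr_strictly_convex.
Context {R : realType}.

(* Chains [1 + (r - 1) u < exp ((r - 1) u)] and [1 - u < exp (- u)] at [u = ln t]. *)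
Lemma powR_gt_tangent (t r : R) : 1 < r -> 0 <= t -> t != 1 -> 1 + r * (t - 1) < t `^ r.
Proof.
move=> r1; rewrite le_eqVlt => /predU1P[<- _|t0 tN1].
  by rewrite powR0 ?gt_eqF ?(lt_trans _ r1)//; lra.
have u0 : ln t != 0 by rewrite ln_eq0.
have tE : expR (ln t) = t by rewrite lnK.
have A : t * (1 + (r - 1) * ln t) < t `^ r.
  rewrite /powR gt_eqF// (_ : r * ln t = ln t + (r - 1) * ln t); last by ring.
  rewrite expRD tE ltr_pM2l// expR_gt1Dx// mulf_neq0// subr_eq0.
  by rewrite gt_eqF.
have B : t - 1 < t * ln t.
  have : 1 + - ln t < expR (- ln t) by rewrite expR_gt1Dx// oppr_eq0.
  by rewrite -(ltr_pM2l t0) expRN tE divff ?gt_eqF//; lra.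
have C : (r - 1) * (t - 1) < (r - 1) * (t * ln t) by rewrite ltr_pM2l ?subr_gt0.
apply: lt_trans A; lra.
Qed.

(** After division by the midpoint the two numbers sum to 2, so in the sum of the two tangent
    inequalities at 1 the linear terms cancel. *)
Lemma powR_midpoint_lt (a b r : R) : 1 < r -> 0 <= a -> 0 <= b -> a != b ->
  ((a + b) / 2) `^ r < (a `^ r + b `^ r) / 2.
Proof.
move=> r1 a0 b0 ab; set m := (a + b) / 2.
have m0 : 0 < m.
  rewrite divr_gt0// lt_def addr_ge0// andbT paddr_eq0//.
  by apply: contraNN ab => /andP[/eqP -> /eqP ->].
have mE : a / m + b / m = 2.
  by rewrite -mulrDl /m invf_div mulrCA divff ?mulr1// gt_eqF//; rewrite /m in m0; lra.
have am0 : 0 <= a / m by exact: divr_ge0 a0 (ltW m0).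
have bm0 : 0 <= b / m by exact: divr_ge0 b0 (ltW m0).
have aE : a `^ r = (a / m) `^ r * m `^ r.
  by rewrite -powRM ?(ltW m0)// divfK// gt_eqF.
have bE : b `^ r = (b / m) `^ r * m `^ r.
  by rewrite -powRM ?(ltW m0)// divfK// gt_eqF.
have am : a / m != 1.
  apply: contra_neq ab => /divr1_eq => am.
  by rewrite /m in am; lra.
have bm : b / m != 1.
  apply: contra_neq ab => /divr1_eq => bm.
  by rewrite /m in bm; lra.
have A := powR_gt_tangent r1 am0 am.
have B := powR_gt_tangent r1 bm0 bm.
rewrite aE bE -mulrDl mulrAC -[ltLHS]mul1r ltr_pM2r ?powR_gt0//.
rewrite ltr_pdivlMr// mul1r; apply: le_lt_trans (ltrD A B).
by rewrite addrACA -mulrDr addrACA mE; lra.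
Qed.

Lemma powR_midpoint_le (a b r : R) : 1 < r -> 0 <= a -> 0 <= b ->
  ((a + b) / 2) `^ r <= (a `^ r + b `^ r) / 2.
Proof.
move=> r1 a0 b0; have [->|ab] := eqVneq a b; last exact/ltW/powR_midpoint_lt.
have half (z : R) : (z + z) / 2 = z by lra.
by rewrite !half.
Qed.

Local Notation C := (complex_scalars R).

Lemma rnorm_half (z : R[i]) : rnorm (2^-1 * z : C^o) = rnorm (z : C^o) / 2.
Proof.
rewrite (rnormM (S := C)) mulrC; congr (_ * _).
apply: (@of_real_inj _ C); rewrite rnormK gtr0_norm ?invr_gt0//.
by rewrite fmorphV rmorph_nat.
Qed.

Lemma complex_powR_midpoint_le (x y : R[i]) r : 1 < r ->
  rnorm (2^-1 * (x + y) : C^o) `^ r <= (rnorm (x : C^o) `^ r + rnorm (y : C^o) `^ r) / 2.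
Proof.
move=> r1; apply: le_trans (powR_midpoint_le r1 (rnorm_ge0 _) (rnorm_ge0 _)).
apply: ge0_ler_powR; rewrite ?nnegrE ?rnorm_ge0 ?divr_ge0 ?addr_ge0 ?rnorm_ge0//.
  by rewrite (le_trans _ (ltW r1)).
by rewrite rnorm_half ler_pM2r ?invr_gt0// rnormD.
Qed.

(** If the moduli differ, the power function gives strictness. If they agree, the triangle
    inequality does: its equality case puts x and y on one ray, hence makes them equal. *)
Lemma complex_powR_midpoint_lt (x y : R[i]) r : 1 < r -> x != y ->
  rnorm (2^-1 * (x + y) : C^o) `^ r < (rnorm (x : C^o) `^ r + rnorm (y : C^o) `^ r) / 2.
Proof.
move=> r1 xy; have r0 : 0 < r by exact: lt_trans r1.
have [nxy|nxy] := eqVneq (rnorm (x : C^o)) (rnorm (y : C^o)); last first.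
  apply: le_lt_trans (powR_midpoint_lt r1 (rnorm_ge0 _) (rnorm_ge0 _) nxy).
  apply: ge0_ler_powR; rewrite ?nnegrE ?rnorm_ge0 ?divr_ge0 ?addr_ge0 ?rnorm_ge0//.
    exact: ltW.
  by rewrite rnorm_half ler_pM2r ?invr_gt0// rnormD.
apply: lt_le_trans (powR_midpoint_le r1 (rnorm_ge0 _) (rnorm_ge0 _)).
apply: gt0_ltr_powR; rewrite ?nnegrE ?rnorm_ge0 ?divr_ge0 ?addr_ge0 ?rnorm_ge0//.
rewrite rnorm_half ltr_pM2r ?invr_gt0// lt_neqAle rnormD andbT.
apply: contra_neq xy => nD.
have : `|x + y| = `|x| + `|y|.
  by rewrite -(rnormK (S := C) (x + y : C^o)) nD rmorphD !rnormK.
move=> /normCDeq [t _ [-> ->]]; congr (_ * _).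
by rewrite -(rnormK (S := C) (x : C^o)) nxy rnormK.
Qed.

Lemma lr_strictly_convex r (r1 : 1 < r) (r1' : 1 <= r) : strictly_convex (lr C r1').
Proof.
have r0 : 0 < r by exact: lt_trans r1.
move=> x y x1 y1 xy.
have norm1 (z : lr C r1') : `|z| = 1 -> lr_norm r z = 1.
  by move=> z1; apply: (@of_real_inj _ C); rewrite -lr_normE z1 rmorph1.
set z := (2^-1 : R[i]) *: (x + y).
have zE i : z i = 2^-1 * (x i + y i) by [].
have [i0 i0xy] : exists i, x i != y i.
  apply: contrapT => /forallNP nex; move/eqP: xy; apply; apply/val_inj/funext => i.
  by apply/eqP; move/negP: (nex i); rewrite negbK.
pose h i := (moduli x i `^ r + moduli y i `^ r) / 2 - moduli z i `^ r.
have h0 i : 0 <= h i by rewrite subr_ge0 /moduli zE complex_powR_midpoint_le.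
have hi0 : 0 < h i0 by rewrite subr_gt0 /moduli zE complex_powR_midpoint_lt.
have S1 (u : lr C r1') n : `|u| = 1 -> series (fun i => moduli u i `^ r) n <= 1.
  move=> u1; apply: le_trans (lr_bound r1' n (lrP u)) _.
  by rewrite norm1// powR1.
(* The gain at the single index i0 where x and y differ survives in all partial sums; n is enlarged
   so that i0 is counted. *)
have zh n : series (fun i => moduli z i `^ r) n <= 1 - h i0.
  apply: (@le_trans _ _ (series (fun i => moduli z i `^ r) (maxn n i0.+1))).
    by apply: nondecreasing_series; [move=> i _ _; exact: powR_ge0|exact: leq_maxl].
  set N := maxn _ _.
  have hN : h i0 <= series h N.
    apply: (@le_trans _ _ (series h i0.+1)).
      by rewrite seriesSr lerDr; apply: sumr_ge0.
    by apply: nondecreasing_series => //; exact: leq_maxr.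
  have := S1 x N x1; have := S1 y N y1; move: hN.
  rewrite /h /series/= sumrB -mulr_suml big_split/=; lra.
have g1 : 0 <= 1 - h i0 by have := zh 0%N; rewrite /series/= big_geq.
rewrite lr_normE -(rmorph1 (of_real C)) (leW_mono (@of_real_le _ C)).
have [] := @lr_boundP _ C r r1' z ((1 - h i0) `^ r^-1) (powR_ge0 _ _).
  by move=> n; rewrite -powRrM mulVf ?gt_eqF// powRr1.
move=> _ /le_lt_trans; apply; rewrite [ltRHS](_ : 1 = 1 `^ r^-1); last by rewrite powR1.
by apply: gt0_ltr_powR; rewrite ?nnegrE ?invr_gt0// gtrBl.
Qed.

End lr_strictly_convex.

(** * The polynomial (sum_i x_i ^ N) v *)

Lemma coef_translated_power {K : numFieldType} (Y : lmodType K) k m (x : K) (y v : Y) :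
  (0 < m <= k)%N -> coef k m (fun t => y + (x + t) ^+ m *: v) = v.
Proof.
move=> /andP[m0 mk].
pose a i := if (i <= m)%N then (x ^+ (m - i) *+ 'C(m, i)) *: v else 0.
rewrite (coef_powers (c := fun i => (if i == 0%N then y else 0) + a i))//.
  by rewrite gtn_eqF// add0r /a leqnn subnn expr0 binn scale1r.
move=> t _; under [RHS]eq_bigr => i _ do rewrite scalerDr.
rewrite big_split/=; congr (_ + _).
  rewrite big_ord_recl/= expr0 scale1r big1 ?addr0// => i _.
  by rewrite scaler0.
rewrite /a -(sum_powers_widen (fun i => (x ^+ (m - i) *+ 'C(m, i)) *: v) t mk).
rewrite exprDn scaler_suml; apply: eq_bigr => i _.
by rewrite scalerA -mulrnAl mulrC.
Qed.

Lemma absolutely_bounded_series {R : realType} (u : nat -> R) B :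
  (forall n, \sum_(0 <= i < n) `|u i| <= B) -> cvgn (series u) /\ `|limn (series u)| <= B.
Proof.
move=> uB.
have cu : cvgn (series u).
  apply: normed_cvg; apply: nondecreasing_is_cvgn.
    by apply: nondecreasing_series => i _ _; exact: normr_ge0.
  by exists B => _ [n _ <-]; exact: uB.
split=> //; rewrite ler_norml; apply/andP; split.
  apply: limr_ge => //; near=> n; rewrite lerNl (le_trans _ (uB n))//.
  by rewrite /series/= -sumrN ler_sum// => i _; rewrite -normrN ler_norm.
apply: limr_le => //; near=> n; apply: le_trans (uB n).
by apply: ler_sum => i _; exact: ler_norm.
Unshelve. all: by end_near. Qed.

(** The n-th power of the largest factor dominates the product. This crude bound replaces Hölder's
    inequality for the summability of products of N sequences. *)
Lemma prod_le_sum_exp {R : realType} n (a : 'I_n -> R) : (0 < n)%N -> (forall i, 0 <= a i) ->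
  \prod_(i < n) a i <= \sum_(i < n) a i ^+ n.
Proof.
case: n a => // n a _ a0.
have [i _ ai] := @arg_maxP _ _ _ ord0 xpredT a isT.
apply: (@le_trans _ _ (a i ^+ n.+1)); last first.
  by rewrite [leRHS](bigD1 i)//= lerDl sumr_ge0// => j _; exact: exprn_ge0.
rewrite -[n.+1 in leRHS]card_ord -prodr_const; apply: ler_prod => j _.
by rewrite a0; exact: ai.
Qed.

Section complex_sum.
Context {R : realType}.
Local Notation C := (complex_scalars R).
Implicit Types a b : nat -> C^o.

(** Taken componentwise so that convergence reduces to real series; the price is the bound B + B in
    [norm_csum_le], harmless since only boundedness is needed. *)
Definition csum a : R[i] :=
  (limn (series (fun i => complex.Re (a i))) +i* limn (series (fun i => complex.Im (a i))))%C.

Definition absolutely_bounded a (B : R) := forall n, series (moduli a) n <= B.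

Lemma norm_Re_le a i : `|complex.Re (a i)| <= moduli a i.
Proof. by rewrite -lecR [in leRHS](rnormK (S := C)); exact: normc_ge_Re. Qed.

Lemma norm_Im_le a i : `|complex.Im (a i)| <= moduli a i.
Proof.
rewrite -lecR [in leRHS](rnormK (S := C)) normc_def lecR -sqrtr_sqr ler_wsqrtr//.
by rewrite lerDr sqr_ge0.
Qed.

Lemma csum_Re a B : absolutely_bounded a B ->
  cvgn (series (fun i => complex.Re (a i))) /\
  `|limn (series (fun i => complex.Re (a i)))| <= B.
Proof.
move=> aB; apply: absolutely_bounded_series => n; apply: le_trans (aB n).
by apply: ler_sum => i _; exact: norm_Re_le.
Qed.

Lemma csum_Im a B : absolutely_bounded a B ->
  cvgn (series (fun i => complex.Im (a i))) /\
  `|limn (series (fun i => complex.Im (a i)))| <= B.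
Proof.
move=> aB; apply: absolutely_bounded_series => n; apply: le_trans (aB n).
by apply: ler_sum => i _; exact: norm_Im_le.
Qed.

Lemma norm_csum_le a B : absolutely_bounded a B -> `|csum a| <= real_complex R (B + B).
Proof.
move=> aB; rewrite [csum a]complexE rmorphD (le_trans (ler_normD _ _))//.
have nR (x : R) : `|real_complex R x| = real_complex R `|x|.
  by rewrite normc_def/= expr0n/= addr0 sqrtr_sqr.
rewrite normrM complexiE normCi mul1r !nR lerD// lecR.
  exact: (csum_Re aB).2.
exact: (csum_Im aB).2.
Qed.

Lemma csum_linear a b A B (t : R[i]) : absolutely_bounded a A -> absolutely_bounded b B ->
  csum (fun i => t * a i + b i) = t * csum a + csum b.
Proof.
move=> aA bB.
have [ra _] := csum_Re aA; have [ia _] := csum_Im aA.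
have [rb _] := csum_Re bB; have [ib _] := csum_Im bB.
case: t => p q; rewrite /csum; simpc; congr (_ +i* _)%C; apply/cvg_lim => //.
  rewrite (_ : series _ = (fun n => (p * series (fun i => complex.Re (a i)) n -
    q * series (fun i => complex.Im (a i)) n) + series (fun i => complex.Re (b i)) n)).
    by apply: cvgD => //; apply: cvgB; apply: cvgMr.
  apply/funext => n; rewrite /series/= !mulr_sumr -sumrB -big_split/=.
  by apply: eq_bigr => i _; case: (a i) => ? ?; case: (b i) => ? ?.
rewrite (_ : series _ = (fun n => (p * series (fun i => complex.Im (a i)) n +
  q * series (fun i => complex.Re (a i)) n) + series (fun i => complex.Im (b i)) n)).
  by apply: cvgD => //; apply: cvgD; apply: cvgMr.
apply/funext => n; rewrite /series/= !mulr_sumr -!big_split/=.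
by apply: eq_bigr => i _; case: (a i) => ? ?; case: (b i) => ? ?.
Qed.

Lemma csum_unit_seq j : csum (unit_seq (S := C) j) = 1.
Proof.
have lim1 : limn (series (fun i => (i == j)%:R : R)) = 1.
  apply/cvg_lim => //; apply: cvg_near_cst; near=> n.
  have jn : (j < n)%N by near: n; exact: nbhs_infty_gt.
  rewrite /series/= big_mkord (bigD1 (Ordinal jn))//= eqxx big1 ?addr0// => i.
  by rewrite -val_eqE/= => /negPf ->.
rewrite /csum -[RHS]/(1 +i* 0)%C; congr (_ +i* _)%C.
  rewrite -[RHS]lim1; congr (limn (series _)); apply/funext => i.
  by rewrite /unit_seq; case: eqP.
apply/cvg_lim => //; rewrite (_ : series _ = fun=> 0); first exact: cvg_cst.
apply/funext => n; rewrite /series/= big1// => i _.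
by rewrite /unit_seq; case: eqP.
Unshelve. all: by end_near. Qed.

Lemma absolutely_bounded_unit_seq j : absolutely_bounded (unit_seq (S := C) j) 1.
Proof.
move=> n; have := fset_sum_unit_seq (S := C) j [fset i in iota 0 n]%fset.
apply: le_trans; rewrite /series/= /index_iota subn0 le_eqVlt; apply/orP; left; apply/eqP.
by apply: perm_big; apply: uniq_perm; rewrite ?iota_uniq ?fset_uniq// => i; rewrite inE.
Qed.

End complex_sum.

Section power_sum_polynomial.
Context {R : realType} {w : nat -> R} (adm : admissible w).
Local Notation C := (complex_scalars R).
Local Notation X := (dstar C adm).
Context {N : nat} (N2 : (2 <= N)%N) (wN : lr_mem (S := real_scalars R) N%:R w).

Let N1 : 1 < N%:R :> R. Proof. by rewrite ltr1n. Qed.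

Lemma moduli_power_sum_le (x : X) n :
  \sum_(0 <= i < n) moduli x i ^+ N <= lr_norm (S := C) N%:R x ^+ N.
Proof.
have := lr_bound (ltW N1) n (dstar_lr N1 wN x).1.
rewrite powR_mulrn ?powR_ge0//; apply: le_trans.
by apply: ler_sum => i _; rewrite powR_mulrn// moduli_ge0.
Qed.

Lemma rnorm_prod n (a : 'I_n -> R[i]) :
  rnorm (\prod_(l < n) a l : C^o) = \prod_(l < n) rnorm (a l : C^o).
Proof.
apply: (@of_real_inj _ C); rewrite rnormK rmorph_prod normr_prod.
by apply: eq_bigr => l _; rewrite rnormK.
Qed.

Lemma absolutely_bounded_prod (u : 'I_N -> X) :
  absolutely_bounded (fun n => \prod_(l < N) u l n : C^o)
    (\sum_(l < N) lr_norm (S := C) N%:R (u l) ^+ N).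
Proof.
move=> n; rewrite /series/=.
apply: (@le_trans _ _ (\sum_(0 <= i < n) \sum_(l < N) moduli (u l) i ^+ N)).
  apply: ler_sum => i _; rewrite [leLHS](rnorm_prod (fun l => u l i)).
  by apply: prod_le_sum_exp => [|l]; [exact: ltnW|exact: rnorm_ge0].
by rewrite exchange_big/=; apply: ler_sum => l _; exact: moduli_power_sum_le.
Qed.

Variable Y : normedModType R[i].

Definition power_sum_form (v : Y) (u : 'I_N -> X) : Y :=
  csum (fun n => \prod_(l < N) u l n) *: v.

Lemma power_sum_form_multilinear v : multilinear (power_sum_form v).
Proof.
move=> l u t x y; rewrite /power_sum_form scalerA -scalerDl; congr (_ *: _).
pose p n : R[i] := \prod_(i < N | i != l) u i n.
have E (z : X) : (fun n => \prod_(i < N) dfwith u l z i n) = (fun n => z n * p n).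
  apply/funext => n; rewrite (bigD1 l)//= dfwithin; congr (_ * _).
  by apply: eq_bigr => i il; rewrite dfwithout// eq_sym.
have H (z : X) : absolutely_bounded (fun n => z n * p n : C^o)
    (\sum_(i < N) lr_norm (S := C) N%:R (dfwith u l z i) ^+ N).
  by rewrite -E; exact: absolutely_bounded_prod.
rewrite !E -(csum_linear t (H x) (H y)); congr csum; apply/funext => n.
by rewrite -[(t *: x + y : X) n]/(t * x n + y n) mulrDl mulrA.
Qed.

Lemma power_sumE v (x : X) : power_sum_form v (fun=> x) = csum (fun n => x n ^+ N) *: v.
Proof. by congr (csum _ *: _); apply/funext => n; rewrite prodr_const card_ord. Qed.

Lemma power_sum_poly_mem v k : (N <= k)%N ->
  poly_mem k (fun x : X => power_sum_form v (fun=> x)).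
Proof.
move=> Nk; apply: (cont_homog_poly_mem Nk).
pose L := (\sum_(l < N) lr_norm (S := real_scalars R) N%:R w ^+ N).
apply: (multilinear_cont_homog_poly (B := real_complex R (L + L) * `|v|)).
  exact: power_sum_form_multilinear.
move=> x x1; rewrite normrZ ler_wpM2r//; apply: norm_csum_le => n.
apply: le_trans (absolutely_bounded_prod (fun=> x) n) _.
apply: ler_sum => l _; apply: lerXn2r; [exact: powR_ge0|exact: powR_ge0|].
have := norm_incl_le (S := C) (adm := adm) N1 wN (ltW N1) x1.
by rewrite lr_normE of_real_le.
Qed.

Definition power_sum_poly v k (Nk : (N <= k)%N) : npoly k X Y :=
  NPoly (mem_set (power_sum_poly_mem v Nk)).

(** Moving along [unitv adm j] changes one summand only, from x_j ^ N to (x_j + t) ^ N, whose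
    leading coefficient depends neither on x nor on j. *)
Lemma coef_power_sum_poly v k (Nk : (N <= k)%N) x j :
  coef k N (fun t => power_sum_poly v Nk (x + t *: unitv adm j)) = v.
Proof.
pose z := csum (fun n => x n ^+ N) - x j ^+ N.
rewrite -[RHS](coef_translated_power (k := k) (m := N) (x j) (z *: v) v); last first.
  by rewrite (ltnW N2).
apply: eq_bigr => s _; congr (_ *: _); set t := node s.
rewrite [LHS]power_sumE -scalerDl; congr (_ *: _).
have xb : absolutely_bounded (fun n => x n ^+ N : C^o)
    (\sum_(l < N) lr_norm (S := C) N%:R x ^+ N).
  rewrite (_ : (fun n => _) = fun n => \prod_(l < N) x n).
    exact: absolutely_bounded_prod.
  by apply/funext => n; rewrite prodr_const card_ord.
rewrite /z -addrA [RHS]addrC [- _ + _]addrC -[X in _ = X + _]mulr1 -(csum_unit_seq j).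
rewrite -(csum_linear _ (absolutely_bounded_unit_seq j) xb).
congr csum; apply/funext => n; rewrite dstarE_lin /unit_seq.
have [->|_] := eqVneq n j; first by rewrite !mulr1 subrK.
by rewrite !mulr0 addr0 add0r.
Qed.

End power_sum_polynomial.

(** * Coefficients along far coordinates *)

Section homogeneous_part.
Context {K : numFieldType}.

(** The i-th Taylor term of F at x in the direction y, that is, the i-th derivative divided by
    i!. *)
Definition homog_part {X Y : lmodType K} k i (F : X -> Y) x y : Y :=
  coef k i (fun t => F (x + t *: y)).

Lemma homog_part_polyline (X Y : lmodType K) k i (F : X -> Y) x :
  polyline k F -> polyline k (homog_part k i F x).
Proof.
move=> pF y z; apply: polyfun_sum => s; apply: polyfunZ.
have [c fc] := polyfun_dilate (node s) (pF (x + node s *: y) z).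
by exists c => t; rewrite -fc scalerDr addrA scalerA mulrC.
Qed.

Lemma homog_partZ (X Y : lmodType K) k i (F : X -> Y) x y s :
  polyline k F -> (i <= k)%N -> homog_part k i F x (s *: y) = s ^+ i *: homog_part k i F x y.
Proof.
move=> pF ik; rewrite /homog_part.
rewrite (coef_powers (c := fun q => s ^+ q *: coef k q (fun t => F (x + t *: y))))//.
move=> t _; rewrite scalerA (polyfun_coef (pF x y)).
by apply: eq_bigr => q _; rewrite scalerA exprMn.
Qed.

Lemma homog_part_bounded (X Y : normedModType K) k i (F : X -> Y) x :
  polyline k F -> (exists B, forall y, `|y| <= 1 -> `|F y| <= B) ->
  exists B, forall y, `|y| <= 1 -> `|homog_part k i F x y| <= B.
Proof.
move=> pF [B FB].
have B0 : 0 <= B by apply: le_trans (FB 0 _); rewrite ?normr0.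
have x0 : 0 < `|x| + 1 by rewrite ltr_wpDl.
exists (interp_norm k * (dilation_const k (`|x| + 1) * B)) => y y1.
apply: norm_coef_le => [|s]; first by rewrite mulr_ge0 ?dilation_const_ge0// ltW.
apply: polyline_dilate => //; rewrite (le_trans (ler_normD _ _))// lerD2l.
by rewrite normrZ mulr_ile1// norm_node_le1.
Qed.

(* Compares the expansions of both sides of [G (y + t e) = t ^ i G (e + t^-1 y)],
   multiplied by [t ^ (k - i)]. *)
Lemma homog_coef (X Y : lmodType K) k i (G : X -> Y) y e q :
  polyline k G -> (forall s x, G (s *: x) = s ^+ i *: G x) -> (i <= k)%N -> (q <= k)%N ->
  coef k q (fun t => G (y + t *: e)) =
  if (q <= i)%N then coef k (i - q) (fun t => G (e + t *: y)) else 0.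
Proof.
move=> pG hG ik qk.
pose g q := coef k q (fun t => G (y + t *: e)).
pose h q := coef k q (fun t => G (e + t *: y)).
pose f (t : K) := t ^+ (k - i) *: G (y + t *: e).
have c1 : coef (k - i + k) (k - i + q) f = g q.
  rewrite (coef_powers (c := fun p => if (p < k - i)%N then 0 else g (p - (k - i))%N)).
  - by rewrite ltnNge leq_addr/= addKn.
  - by rewrite leq_add2l.
  move=> t _; rewrite /f (polyfun_coef (pG y e)) scaler_sumr.
  rewrite -[(k - i + k).+1]addnS big_split_ord/= [X in _ = X + _]big1 ?add0r; last first.
    by move=> j _; rewrite ltn_ord scaler0.
  by apply: eq_bigr => j _; rewrite scalerA -exprD ltnNge leq_addr/= addKn.
have c2 : coef (k - i + k) (k - i + q) f =
    if (k - i + q <= k)%N then h (k - (k - i + q))%N else 0.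
  rewrite (coef_powers (c := fun p => if (p <= k)%N then h (k - p)%N else 0))//.
    by rewrite leq_add2l.
  move=> t t0; rewrite -(sum_powers_widen (fun p => h (k - p)%N)) ?leq_addl//.
  have -> : f t = t ^+ k *: G (e + t^-1 *: y).
    rewrite /f -[in t ^+ k](subnK ik) exprD -scalerA -hG scalerDr scalerA divff// scale1r.
    by rewrite addrC.
  rewrite (polyfun_coef (pG e y)) scaler_sumr [RHS](reindex_inj rev_ord_inj)/=.
  apply: eq_bigr => j _; have jk : (j <= k)%N by rewrite -ltnS ltn_ord.
  by rewrite subSS scalerA exprVn -exprB ?leq_subr ?unitfE// subKn.
rewrite -/(g q) -c1 c2 -leq_subRL ?leq_subr// subKn//.
by rewrite subnDA subKn.
Qed.

Lemma homog_expansion (X Y : lmodType K) k i (G : X -> Y) y e t :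
  polyline k G -> (forall s x, G (s *: x) = s ^+ i *: G x) -> (0 < i <= k)%N ->
  G (y + t *: e) = G y +
    \sum_(q < i.-1) t ^+ q.+1 *: coef k q.+1 (fun t => G (y + t *: e)) + t ^+ i *: G e.
Proof.
move=> pG hG /andP[i0 ik].
rewrite (polyfun_coef (pG y e)) [LHS](_ : _ =
  \sum_(q < i.+1) t ^+ q *: coef k q (fun t => G (y + t *: e))); last first.
  rewrite (sum_powers_widen (fun q => coef k q (fun t => G (y + t *: e))) t ik).
  apply: eq_bigr => q _; case: ifP => // qi.
  by rewrite (homog_coef _ _ pG hG)// ?qi// -ltnS.
have E0 x z : coef k 0 (fun t => G (x + t *: z)) = G x.
  have := polyfun_coef (pG x z) 0; rewrite scale0r addr0 => H; rewrite [RHS]H.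
  rewrite big_ord_recl expr0 scale1r big1 ?addr0// => q _.
  by rewrite expr0n scale0r.
rewrite big_ord_recr/= (homog_coef _ _ pG hG)// leqnn subnn E0; congr (_ + _).
by case: i i0 {hG ik} => // i _; rewrite big_ord_recl/= expr0 scale1r E0.
Qed.

End homogeneous_part.

Section vanishing_coefficients.
Context {R : realType} {w : nat -> R} (adm : admissible w).
Local Notation S := (real_scalars R).
Local Notation X := (dstar S adm).
Implicit Types (x y : X) (F G : X -> R^o).

(* Given [G (unitv j) > e] for infinitely many [j], a greedy choice of indices
   makes the cross terms of [G] negligible along [y = \sum_(l < n) w l *: unitv (j l)],
   so that [G y >= e / 2 * \sum_(l < n) w l ^+ i], while [`|y| <= 1]. *)
Lemma homog_unitv_small k i G (e : R) : polyline k G ->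
  (exists B : R, forall y, `|y| <= 1 -> `|G y| <= B) ->
  (forall (s : S) x, G (s *: x) = s ^+ i *: G x) -> (0 < i <= k)%N ->
  (forall q, (0 < q < i)%N -> forall y (d : R), 0 < d ->
    \forall j \near \oo, `|coef k q (fun t => G (y + t *: unitv adm j))| <= d) ->
  (forall A, exists n, A < \sum_(l < n) w l ^+ i) -> 0 < e ->
  \forall j \near \oo, G (unitv adm j) <= e.
Proof.
move=> pG [B GB] hG /andP[i0 ik] small wi e0; apply: contrapT => nex.
have big n0 : exists2 j, (n0 <= j)%N & e < G (unitv adm j).
  apply: contrapT => nj; apply: nex; exists n0 => // j /= nj0.
  by rewrite leNgt; apply/negP => ej; apply: nj; exists j.
(* Truncation at n leaves room for one more entry of modulus w n, and finite support lets the new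
   index be one where y vanishes. *)
have step n : exists y, [/\ exists b, forall l, (b <= l)%N -> y l = 0,
    forall J : {fset nat}, \sum_(l <- J) moduli y l <= series w (minn #|` J| n) &
    e / 2 * \sum_(l < n) w l ^+ i <= G y].
  elim: n => [|n [y [[b yb] yJ Gy]]].
    exists 0; split; first by exists 0%N.
      by move=> J; rewrite minn0 /series/= big_geq// big1// => l _; exact: normr0.
    have := hG 0 0; rewrite scaler0 expr0n gtn_eqF// scale0r => ->.
    by rewrite big_ord0 mulr0.
  have wn := admissible_gt0 adm n.
  (* There are i - 1 cross terms, so with this d they cost at most half of the gain e w_n ^ i. *)
  pose d := e / 2 * w n ^+ i / i%:R.
  have d0 : 0 < d by rewrite !(divr_gt0, mulr_gt0) ?exprn_gt0 ?ltr0n.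
  have [n0 _ n0P] : \forall j \near \oo, forall q : 'I_i.-1,
      `|coef k q.+1 (fun t => G (y + t *: unitv adm j))| <= d.
    apply: filter_forall => q; apply: small => //=.
    by rewrite -[leqRHS]prednK// ltnS ltn_ord.
  have [j jn0 ej] := big (maxn n0 b).
  have bj : (b <= j)%N by apply: leq_trans jn0; exact: leq_maxr.
  exists (y + (w n : S) *: (unitv adm j : X)); split.
  - exists (maxn b j.+1) => l; rewrite geq_max => /andP[bl jl].
    by rewrite dstarE_lin yb// gtn_eqF// mulr0 addr0.
  - move=> J; have [jJ|jJ] := boolP (j \in J); last first.
      rewrite fset_sum_update_notin//; apply: le_trans (yJ J) _.
      by apply: admissible_series_homo => //; rewrite leq_min geq_minl leqW ?geq_minr.
    rewrite fset_sum_update//; have := cardfsD1 j J; rewrite jJ add1n => ->.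
    rewrite minnSS seriesSr addrC.
    have := yJ (J `\ j)%fset; set m := #|` _| => ym; apply: (lerD ym).
    apply: (@le_trans _ _ (w n)); last by apply: admissible_le => //; exact: geq_minr.
    apply: le_trans (moduli_eq_le _ _ _) _.
    by rewrite /moduli yb// rnorm0 add0r /rnorm/= gtr0_norm.
  - rewrite (homog_expansion _ _ _ pG hG) ?i0//.
    set Z := (X in _ <= G y + X + _).
    have Zd : `|Z| <= e / 2 * w n ^+ i.
      apply: (@le_trans _ _ (\sum_(q < i.-1) d)).
        rewrite (le_trans (ler_norm_sum _ _ _))//; apply: ler_sum => q _.
        rewrite normrZ -[leRHS]mul1r ler_pM//.
          by rewrite normrX gtr0_norm// exprn_ile1 ?(ltW wn)// admissible_le1.
        by apply: n0P; apply: leq_trans jn0; exact: leq_maxl.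
      rewrite sumr_const card_ord -[d *+ _]mulr_natr /d -mulrA; apply: ler_piMr.
        by rewrite mulr_ge0 ?exprn_ge0 ?divr_ge0 ?ltW.
      by rewrite mulrC ler_pdivrMr ?ltr0n// mul1r ler_nat leq_pred.
    have eG : w n ^+ i * e <= w n ^+ i *: G (unitv adm j).
      by rewrite ler_wpM2l ?exprn_ge0 ?ltW.
    move: Zd; rewrite ler_norml => /andP[Zd _].
    by rewrite big_ord_recr/= mulrDr; lra.
have [n An] := wi (B / (e / 2)).
have [y [_ yJ Gy]] := step n.
have /GB : `|y| <= 1.
  apply/dstar_ballP => J; apply: le_trans (yJ J) _.
  by apply: admissible_series_homo => //; exact: geq_minl.
move=> /(le_trans (ler_norm _)) /(le_trans Gy); apply/negP; rewrite -ltNge.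
by rewrite mulrC -ltr_pdivrMr// divr_gt0.
Qed.

(** Strong induction on i: the i-th Taylor term of F at x satisfies the same hypotheses as F, so its
    own coefficients of order below i, the cross terms, vanish in the limit by induction. Applying
    the one-sided bound to F and -F gives the absolute value. *)
Lemma coef_unitv_cvg0 k M F : polyline k F ->
  (exists B : R, forall y, `|y| <= 1 -> `|F y| <= B) ->
  (forall i, (0 < i < M)%N -> forall A, exists n, A < \sum_(l < n) w l ^+ i) ->
  forall i, (0 < i < M)%N -> (i <= k)%N -> forall x (e : R), 0 < e ->
  \forall j \near \oo, `|coef k i (fun t => F (x + t *: unitv adm j))| <= e.
Proof.
move=> + + wM i; elim/ltn_ind: i F => i IH F pF bF iM ik x e e0.
have one F' : polyline k F' -> (exists B : R, forall y, `|y| <= 1 -> `|F' y| <= B) ->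
    \forall j \near \oo, homog_part k i F' x (unitv adm j) <= e.
  move=> pF' bF'; have [i0 iltM] := andP iM.
  have bG := homog_part_bounded i x pF' bF'.
  have pG := homog_part_polyline i x pF'.
  apply: (homog_unitv_small pG bG) => //.
  - by move=> s y; rewrite homog_partZ.
  - by rewrite i0.
  - move=> q /andP[q0 qi] y d d0; apply: IH => //.
      by rewrite q0 (ltn_trans qi iltM).
    exact: leq_trans (ltnW qi) ik.
  - by move=> A; exact: wM.
have pN : polyline k (fun y => - F y).
  move=> y z; have [c fc] := pF y z; exists (fun q => - c q) => t.
  by rewrite fc -sumrN; apply: eq_bigr => q _; rewrite scalerN.
have bN : exists B : R, forall y, `|y| <= 1 -> `|- F y| <= B.
  by have [B FB] := bF; exists B => y /FB; rewrite normrN.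
have cN j : coef k i (fun t => F (x + t *: unitv adm j)) =
    - homog_part k i (fun y => - F y) x (unitv adm j).
  by rewrite /homog_part /coef -sumrN; apply: eq_bigr => s _; rewrite scalerN opprK.
near=> j; rewrite ler_norml; apply/andP; split.
  by rewrite cN lerN2; near: j; exact: one.
by near: j; exact: one.
Unshelve. all: by end_near. Qed.

End vanishing_coefficients.

(** * The real case *)

Section limits_of_polynomials.
Context {R : realType}.

Lemma cvgn_sum k (u : 'I_k -> nat -> R) (l : 'I_k -> R) :
  (forall i, u i @ \oo --> l i) -> (fun n => \sum_(i < k) u i n) @ \oo --> \sum_(i < k) l i.
Proof.
by move=> ul; apply: cvg_big => //; exact: add_continuous.
Qed.

(** The degree bound is common to all f n, and coefficients depend on finitely many values, so they
    converge along with the functions. *)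
Lemma lim_polyfun k (f : nat -> R -> R^o) (g : R -> R^o) : (forall n, polyfun k (f n)) ->
  (forall t, (fun n => f n t) @ \oo --> g t) -> polyfun k g.
Proof.
move=> pf fg; exists (fun q => coef k q g) => t.
have : (fun n => f n t) @ \oo --> \sum_(q < k.+1) t ^+ q *: coef k q g.
  under eq_fun => n do rewrite (polyfun_coef (pf n)).
  apply: cvgn_sum => q; apply: cvgMr; apply: cvgn_sum => s.
  by apply: cvgMr; exact: fg.
exact: (cvg_unique _ (fg t)).
Qed.

Lemma polyfun_exp k n (f : R -> R^o) : polyfun k f -> polyfun (k * n) (fun t => f t ^+ n : R^o).
Proof.
move=> [c fc]; pose p := \poly_(i < k.+1) c i.
have fE t : f t = p.[t].
  rewrite fc horner_poly; apply: eq_bigr => i _; exact: mulrC.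
have sp : (size (p ^+ n) <= (k * n).+1)%N.
  apply: leq_trans (size_poly_exp_leq _ _) _; rewrite ltnS leq_mul//.
  by rewrite -subn1 leq_subLR add1n; exact: size_poly.
exists (fun i => (p ^+ n)`_i) => t; rewrite fE -horner_exp (horner_coef_wide _ sp).
by apply: eq_bigr => i _; exact: mulrC.
Qed.

End limits_of_polynomials.

Section real_lr.
Context {R : realType} {M : nat} (M0 : (0 < M)%N) (Meven : ~~ odd M).
Local Notation S := (real_scalars R).
Local Notation Y := (lr S (natr_ge1 R M0)).

Lemma lr_norm_exp_cvg (u : Y) :
  series (fun i => u i ^+ M : R) @ \oo --> (`|u| ^+ M : R).
Proof.
have E : (fun i => moduli u i `^ M%:R) = (fun i => u i ^+ M).
  apply/funext => i; rewrite powR_mulrn ?moduli_ge0//.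
  by rewrite [LHS](_ : _ = `|u i : R| ^+ M)// -normrX ger0_norm// exprn_even_ge0.
have cu := lrP u; rewrite /lr_mem E in cu.
have -> : (`|u| ^+ M : R) = limn (series (fun i => u i ^+ M : R)).
  rewrite [LHS](_ : _ = lr_norm M%:R u ^+ M)// /lr_norm E -powR_mulrn ?powR_ge0//.
  rewrite -powRrM mulVf ?pnatr_eq0 -?lt0n// powRr1//.
  apply: limr_ge => //; near=> n; apply: sumr_ge0 => i _.
  exact: exprn_even_ge0.
exact: cu.
Unshelve. all: by end_near. Qed.

Lemma lr_sumE k (u : 'I_k -> Y) i : (\sum_(q < k) u q) i = \sum_(q < k) u q i.
Proof.
elim: k u => [|k IH] u; first by rewrite !big_ord0.
by rewrite !big_ord_recr/= -IH.
Qed.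

(** For even M, |u| ^ M is the limit of the partial sums of u_i ^ M without absolute values; along a
    line each of these is a polynomial of degree at most k M. *)
Lemma norm_exp_polyline (X : normedModType S) k (P : X -> Y) : polyline k P ->
  polyline (k * M) (fun x => `|P x| ^+ M : S^o).
Proof.
move=> pP x y.
apply: (lim_polyfun (f := fun n t => series (fun i => P (x + t *: y) i ^+ M : R) n)).
  move=> n; apply: polyfun_sum => i; apply: polyfun_exp.
  have [c fc] := pP x y; exists (fun q => c q i) => t.
  by rewrite fc lr_sumE.
by move=> t; exact: lr_norm_exp_cvg.
Qed.

End real_lr.

Lemma norm_exprB_le {R : realType} (a b B : R) n : 0 <= a <= B -> 0 <= b <= B ->
  `|a ^+ n - b ^+ n| <= `|a - b| * (B ^+ n.-1 *+ n).
Proof.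
move=> /andP[a0 aB] /andP[b0 bB]; rewrite subrXX normrM ler_wpM2l//.
rewrite (le_trans (ler_norm_sum _ _ _))//.
have -> : B ^+ n.-1 *+ n = \sum_(i < n) B ^+ n.-1 by rewrite sumr_const card_ord.
apply: ler_sum => i _; rewrite normrM !normrX !ger0_norm//.
have iE : (n.-1 = (n.-1 - i) + i)%N.
  by rewrite subnK// -ltnS (leq_trans (ltn_ord i))// leqSpred.
by rewrite [in leRHS]iE exprD; apply: ler_pM;
  rewrite ?exprn_ge0// lerXn2r// nnegrE (le_trans a0, le_trans b0).
Qed.

Lemma small_factor {R : realType} (I C : R) : 0 <= I -> 0 <= C ->
  exists e : R, [/\ 0 < e, e <= 1 & I * (C * e) <= 2^-1].
Proof.
move=> I0 C0; have Z0 : 0 <= I * C by exact: mulr_ge0.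
exists (2 * (I * C) + 1)^-1; split; first by rewrite invr_gt0; lra.
  by rewrite invf_le1//; lra.
by rewrite mulrA ler_pdivrMr; lra.
Qed.

Lemma half_le_of_dist {R : realType} (u b : R) : `|1 - u| <= b -> b <= 2^-1 -> 2^-1 <= u.
Proof. by rewrite ler_norml => /andP[_ ub] b2; lra. Qed.

(* For small [t] the term [c m * t ^+ m] dominates. *)
Lemma leading_term_gt0 {R : realType} m k (A d : R) : (0 < m <= k)%N -> 0 <= A -> 0 < d ->
  exists t : R, [/\ 0 < t, t <= d & exists2 eta : R, 0 < eta &
    forall c : nat -> R, (forall q, `|c q| <= A) ->
      (forall q, (0 < q < m)%N -> `|c q| <= eta) -> 2^-1 <= c m ->
      0 < \sum_(q < k) t ^+ q.+1 * c q.+1].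
Proof.
move=> /andP[m0 mk] A0 d0.
have [V V0 VE] : exists2 V : R, 0 <= V & V = k%:R * (1 + A).
  by eexists; last reflexivity; rewrite mulr_ge0// addr_ge0.
have [t [t0 td t1 tV]] : exists t : R, [/\ 0 < t, t <= d, t <= 1 & V * t < 2^-1].
  exists (Num.min (Num.min d 1) (2 * (V + 1))^-1); split.
  - by rewrite !lt_min d0 ltr01 invr_gt0; lra.
  - by rewrite !ge_min lexx.
  - by rewrite !ge_min lexx orbT.
  - apply: (@le_lt_trans _ _ (V * (2 * (V + 1))^-1)).
      by apply: ler_wpM2l => //; rewrite ge_min lexx orbT.
    by rewrite ltr_pdivrMr; lra.
(* With eta = t ^ (m + 1), every term of degree other than m is at least -(1 + A) t ^ (m + 1). All k
   together cost at most V t ^ (m + 1), less than t ^ m / 2. *)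
exists t; split => //; exists (t ^+ m.+1) => [|c cA cS cM]; first exact: exprn_gt0.
have tM : 0 < t ^+ m.+1 by exact: exprn_gt0.
apply: (@lt_le_trans _ _
    (\sum_(q < k) ((q.+1 == m)%:R * (t ^+ m * 2^-1) - (1 + A) * t ^+ m.+1))).
  rewrite sumrB -mulr_suml sumr_const card_ord -[_ *+ k]mulr_natl [k%:R * _]mulrA -VE exprS.
  have -> : \sum_(q < k) (q.+1 == m)%:R = 1 :> R.
    have mk' : (m.-1 < k)%N by rewrite prednK.
    rewrite (bigD1 (Ordinal mk'))//= prednK// eqxx big1 ?addr0// => q.
    by rewrite -val_eqE/= -{2}(prednK m0) eqSS => /negPf ->.
  by rewrite mul1r mulrA [V * t * _]mulrC -mulrBr mulr_gt0 ?exprn_gt0// subr_gt0.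
apply: ler_sum => q _.
have low u b : 0 <= u <= 1 -> `|c q.+1| <= b -> - (u * b) <= u * c q.+1.
  move=> /andP[u0 u1]; rewrite ler_norml => /andP[cb _].
  by rewrite -mulrN ler_wpM2l.
have tq : 0 <= t ^+ q.+1 <= 1 by have t0' := ltW t0; rewrite exprn_ge0 ?exprn_ile1.
have AM : 0 <= A * t ^+ m.+1 by rewrite mulr_ge0// ltW.
have [qm|mq|qm] := ltngtP q.+1 m.
- apply: (@le_trans _ _ (- (t ^+ q.+1 * t ^+ m.+1))); last first.
    by apply: low => //; exact: cS.
  rewrite mul0r sub0r lerN2 mulrDl mul1r (le_trans (y := t ^+ m.+1))//.
    by rewrite ger_pMl//; case/andP: tq.
  by rewrite lerDl.
- apply: (@le_trans _ _ (- (t ^+ q.+1 * A))); last by apply: low => //; exact: cA.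
  rewrite mul0r sub0r lerN2 mulrDl mul1r (le_trans (y := A * t ^+ m.+1))//.
    by rewrite mulrC ler_wpM2l// ler_wiXn2l// ltW.
  by rewrite lerDr ltW.
- rewrite mul1r qm (le_trans (y := t ^+ m * 2^-1))//.
    by rewrite gerBl mulr_ge0 ?addr_ge0// ltW.
  by rewrite ler_wpM2l// exprn_ge0// ltW.
Qed.

(** As w <= 1 and i <= m - 1, a bound on the sums of w ^ i would also bound those of w ^ (m - 1). *)
Lemma weight_powers_unbounded {R : realType} (w : nat -> R) m : admissible w ->
  ~ lr_mem (S := real_scalars R) m.-1%:R w ->
  forall i, (0 < i < m)%N -> forall A, exists n, A < \sum_(l < n) w l ^+ i.
Proof.
move=> adm + i /andP[_ im] A; apply: contra_notP => nA.
apply: nondecreasing_is_cvgn.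
  by apply: nondecreasing_series => l _ _; exact: powR_ge0.
exists A => _ [n _ <-]; rewrite moduli_weights// /series/= big_mkord.
apply: (@le_trans _ _ (\sum_(l < n) w l ^+ i)); last first.
  by rewrite leNgt; apply/negP => An; apply: nA; exists n.
apply: ler_sum => l _; rewrite powR_mulrn ?admissible_ge0//.
by rewrite ler_wiXn2l ?admissible_ge0 ?admissible_le1// -ltnS (ltn_predK im).
Qed.

Section real_case.
Context {R : realType} {w : nat -> R} (adm : admissible w).
Context {M : nat} (M0 : (0 < M)%N) (Meven : ~~ odd M).
Context (wM : lr_mem (S := real_scalars R) M%:R w).
Context (wpow : forall i, (0 < i < M)%N -> forall A, exists n, A < \sum_(l < n) w l ^+ i).
Local Notation S := (real_scalars R).
Local Notation X := (dstar S adm).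
Local Notation Y := (lr S (natr_ge1 R M0)).

Lemma even_gt1 : 1 < M%:R :> R.
Proof. by rewrite ltr1n; case: M M0 Meven => [|[]]. Qed.

Lemma norm_incl_exp (x : X) (t : S) j :
  `|incl even_gt1 wM (natr_ge1 R M0) (x + t *: unitv adm j)| ^+ M =
  (`|incl even_gt1 wM (natr_ge1 R M0) x| ^+ M - x j ^+ M) + (x j + t) ^+ M :> R.
Proof.
have cx := lr_norm_exp_cvg Meven (u := incl even_gt1 wM (natr_ge1 R M0) x).
have cxt := lr_norm_exp_cvg Meven (u := incl even_gt1 wM (natr_ge1 R M0) (x + t *: unitv adm j)).
rewrite -addrA; set c := - _ + _.
set u := (X in X = _) in cxt *; set v := (X in X + c) in cx *.
suff : series (fun i => (x i + t * (i == j)%:R) ^+ M : R) @ \oo --> v + c.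
  exact: (cvg_unique _ cxt).
(* Only the j-th summand changes, so the partial sums differ by the constant c as soon as n > j. *)
suff cj : (fun n => if (j < n)%N then c else 0) @ \oo --> c.
  rewrite (_ : series _ = (fun n => series (fun i => x i ^+ M : R) n +
    (if (j < n)%N then c else 0))); first exact: cvgD.
  apply/funext => n; rewrite /series/= !big_mkord; case: ifP => jn.
    rewrite (bigD1 (Ordinal jn))//= [in RHS](bigD1 (Ordinal jn))//=.
    rewrite eqxx mulr1 /c [RHS]addrACA subrr add0r [RHS]addrC.
    congr (_ + _); apply: eq_bigr => i; rewrite -val_eqE/= => /negPf ij.
    by rewrite ij mulr0 addr0.
  rewrite addr0; apply: eq_bigr => i _; rewrite (_ : (i == j :> nat) = false) ?mulr0 ?addr0//.
  by apply/negbTE; apply: contraFN jn => /eqP <-.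
apply: cvg_near_cst; near=> n; rewrite ifT//; near: n; exact: nbhs_infty_gt.
Unshelve. all: by end_near. Qed.

Lemma coef_norm_incl_exp k (x : X) j : (M <= k)%N ->
  coef k M (fun t : S =>
    `|incl even_gt1 wM (natr_ge1 R M0) (x + t *: unitv adm j)| ^+ M : S^o) = 1.
Proof.
move=> Mk; pose z : S^o := `|incl even_gt1 wM (natr_ge1 R M0) x| ^+ M - x j ^+ M.
transitivity (coef k M (fun t : S => z + (x j + t) ^+ M *: (1 : S^o))).
  congr coef; apply/funext => t; rewrite norm_incl_exp; congr (_ + _).
  exact/esym/mulr1.
by apply: coef_translated_power; rewrite M0.
Qed.

Lemma not_dense_real k (k1 : (1 <= k)%N) : ~ dense (norm_attaining S k X Y).
Proof.
move=> dn.
pose T : npoly k X Y := incl_poly adm even_gt1 wM (natr_ge1 R M0) k1.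
pose K := (k * M)%N.
have MK : (0 < M <= K)%N by rewrite M0 leq_pmull.
have [D D0 DQ] : exists2 D : R, 0 <= D &
    forall (Q : npoly k X Y) y, `|y| <= 2 -> (`|Q y| : R) <= D * `|Q|.
  by exists (dilation_const k 2) => [|Q y]; [exact: dilation_const_ge0|exact: npoly_ball2].
have [I I0 IQ] : exists2 I : R, 0 <= I & forall q (f : S -> S^o) (b : R),
    0 <= b -> (forall s, `|f (node s)| <= b) -> `|coef K q f| <= I * b.
  by exists (interp_norm K) => [|q f b]; [exact: interp_norm_ge0|exact: norm_coef_le].
have [L L0 TL] : exists2 L : R, 0 <= L & `|T| = L by exists `|T|; rewrite ?normr_ge0.
(* B must be fixed before e, which depends on it; L + 1 bounds the norm of every P within distance e
   <= 1 of T. *)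
have [B B0 BD] : exists2 B : R, 0 <= B & B = D * (L + 1).
  by exists (D * (L + 1)); rewrite // mulr_ge0// addr_ge0.
have C0 : 0 <= D * (B ^+ M.-1 *+ M) by rewrite mulr_ge0// mulrn_wge0// exprn_ge0.
have A0 : 0 <= I * B ^+ M by rewrite mulr_ge0// exprn_ge0.
have [e [e0 e1 Ie]] := small_factor I0 C0.
have [|P [TP [x x1 Px]]] := dn (ball T e) _ (ball_open _ _).
  by exists T; exact: ballxx.
move: TP; rewrite -ball_normE /= => TP.
have TPe : (`|T - P| : R) <= e by exact: ltW.
have PL : (`|P| : R) <= L + 1.
  have -> : P = T - (T - P) by rewrite opprB addrC subrK.
  by apply: le_trans (ler_normB _ _) _; rewrite TL lerD2l (le_trans TPe).
pose FP (y : X) : S^o := `|P y| ^+ M.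
pose FT (y : X) : S^o := `|T y| ^+ M.
have TB y : `|y| <= 2 -> 0 <= (`|T y| : R) <= B.
  move=> y2; rewrite normr_ge0/=; apply: le_trans (DQ T y y2) _.
  by rewrite TL BD; apply: ler_wpM2l => //; rewrite lerDl.
have PB y : `|y| <= 2 -> 0 <= (`|P y| : R) <= B.
  move=> y2; rewrite normr_ge0/=; apply: le_trans (DQ P y y2) _.
  by rewrite BD; exact: ler_wpM2l.
have x2 s j : `|x + node s *: unitv adm j| <= 2.
  by apply: norm_add_unitv_le2 => //; exact: norm_node_le1.
have close y : `|y| <= 2 -> (`|FT y - FP y| : R) <= D * (B ^+ M.-1 *+ M) * e.
  move=> y2; apply: le_trans (norm_exprB_le M (TB y y2) (PB y y2)) _.
  rewrite mulrAC ler_wpM2r ?mulrn_wge0 ?exprn_ge0//.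
  apply: le_trans (ler_dist_dist _ _) _.
  apply: le_trans (DQ (T - P) y y2) _.
  exact: ler_wpM2l.
have pFP : polyline K FP.
  by apply: norm_exp_polyline => //; exact: poly_mem_polyline (npolyP P).
have FPB y : `|y| <= 2 -> (`|FP y| : R) <= B ^+ M.
  by move=> /PB/andP[p0 pB]; rewrite normrX normr_id lerXn2r// nnegrE.
pose c q j : R := coef K q (fun t => FP (x + t *: unitv adm j)).
have cA q j : `|c q j| <= I * B ^+ M.
  by apply: IQ => [|s]; [exact: exprn_ge0|exact: FPB].
(* For T this coefficient is exactly 1, and e was chosen so that interpolating the difference of the
   two norm powers loses at most 1/2. *)
have cM j : 2^-1 <= c M j.
  apply: half_le_of_dist Ie.
  rewrite -(coef_norm_incl_exp x j (andP MK).2) /c -coefB.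
  by apply: IQ => [|s]; [exact: mulr_ge0 C0 (ltW e0)|exact: close].
have [n0 [d d0 flat]] := dstar_flat x1.
have [t [t0 td [eta eta0 teta]]] := leading_term_gt0 MK A0 d0.
have [n1 _ n1P] : \forall j \near \oo, forall q : 'I_M, (0 < q)%N -> `|c q j| <= eta.
  apply: filter_forall => q; have [q0|q0] := ltnP 0 q; last first.
    by exists 0%N => // j _; rewrite ltnNge q0.
  have bFP : exists B : R, forall y, `|y| <= 1 -> `|FP y| <= B.
    by exists (B ^+ M) => y y1; apply: FPB; apply: le_trans y1 _; exact: ler1n.
  have qM : (0 < q < M)%N by rewrite q0 ltn_ord.
  have qK : (q <= K)%N by exact: leq_trans (ltnW (ltn_ord q)) (andP MK).2.
  have := coef_unitv_cvg0 pFP bFP wpow qM qK x eta0.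
  by apply: filterS.
(* Beyond n0 the displaced point stays in the unit ball; beyond n1 the lower coefficients are at
   most eta. Both t and eta were fixed independently of j. *)
pose j := maxn n0 n1.
have FPx : FP (x + (t : S) *: unitv adm j) <= FP x :> R.
  have y1 : `|x + (t : S) *: unitv adm j| <= 1.
    by apply: flat; rewrite ?leq_maxl// /rnorm/= gtr0_norm.
  apply: lerXn2r; [exact: normr_ge0|exact: normr_ge0|].
  have := npoly_norm_le P y1; rewrite -Px; exact: id.
have c0 : c 0%N j = FP x.
  have := polyfun_coef (pFP x (unitv adm j)) 0; rewrite scale0r addr0 => H; rewrite [RHS]H.
  rewrite big_ord_recl expr0 scale1r big1 ?addr0// => q _.
  by rewrite expr0n scale0r.
have : 0 < \sum_(q < K) t ^+ q.+1 * c q.+1 j.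
  apply: (teta (c ^~ j)) => // q /andP[q0 qM].
  exact: (n1P j (leq_maxr _ _) (Ordinal qM)).
move: FPx; rewrite (polyfun_coef (pFP x (unitv adm j))) big_ord_recl expr0 scale1r.
rewrite -/(c 0%N j) c0 gerDl => h1 h2.
by have := lt_le_trans h2 h1; rewrite ltxx.
Qed.

End real_case.

Unset Implicit Arguments.

Theorem proposition4p5 (R : realType) (w : nat -> R) (adm : admissible w)
    (N : nat) (N2 : (2 <= N)%N) :
  ((forall W : completeNormedModType R[i],
      (exists v : W, v != 0) -> strictly_convex W ->
      lr_mem (S := real_scalars R) N%:R w ->
      forall k : nat, (N <= k)%N ->
      ~ dense (norm_attaining (complex_scalars R) k
                 (dstar (complex_scalars R) adm) W))
   /\
   (forall (r : R) (r1 : 1 < r),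
      lr_mem (S := real_scalars R) r w ->
      forall k : nat, (1 <= k)%N ->
      ~ dense (norm_attaining (complex_scalars R) k
                 (dstar (complex_scalars R) adm)
                 (lr (complex_scalars R) (ltW r1)))))
  /\
  (forall (M : nat) (M0 : (0 < M)%N), ~~ odd M ->
     lr_mem (S := real_scalars R) M%:R w ->
     ~ lr_mem (S := real_scalars R) M.-1%:R w ->
     forall k : nat, (1 <= k)%N ->
     ~ dense (norm_attaining (real_scalars R) k
                (dstar (real_scalars R) adm)
                (lr (real_scalars R) (natr_ge1 R M0)))).
Proof.
split; first split.
- move=> W [v v0] sc wN k Nk.
  apply: (@not_dense_of_coef R w adm W k N (power_sum_poly adm N2 wN v Nk) `|v|) => //.
  + by rewrite (ltnW N2).
  + by rewrite normr_gt0.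
  + by move=> x j; rewrite coef_power_sum_poly.
- move=> r r1 wr k k1.
  apply: (@not_dense_of_coef R w adm _ k 1%N (incl_poly adm r1 wr (ltW r1) k1) 1) => //.
  + exact: lr_strictly_convex.
  + by move=> x j; rewrite coef_incl_poly; exact: (norm_incl_unitv_ge1 (S := complex_scalars R)).
- move=> M M0 Meven wM wM1 k k1.
  exact: not_dense_real Meven wM (weight_powers_unbounded adm wM1) k k1.
Qed.
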